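(* Let $m>1$ be an odd integer. Let $X$ be a centered Gaussian process with homogeneous increments, i.e. its canonical metric satisfies $$\delta^2(s,t):=\mathbf{E}\left[(X(t)-X(s))^2\right]=\delta^2(|t-s|)$$ for a univariate function, also denoted $\delta^2$, which is assumed to be increasing and concave. Then $X$ has zero odd $m$-th variation on $[0,T]$ if and only if $\delta(r)=o\left(r^{1/(2m)}\right)$ as $r\to 0^+$.
   Context: Fix $T>0$, $\varepsilon_0>0$ and put $T_*=T+\varepsilon_0$. The process $X$ is indexed by $[0,T_*]$ and the univariate function $\delta^2$ is defined on $[0,T_*]$ (with $\delta\ge 0$), so that $X(s+\varepsilon)$ makes sense for $s\in[0,T]$ and $0<\varepsilon\le\varepsilon_0$. It is a standing assumption that the centered Gaussian process $X$ is represented as $X(t)=\int_0^{T_*}G(t,s)\,dW(s)$, where $W$ is a standard Brownian motion and $G$ is a non-random measurable function on $[0,T_*]^2$ with $G(t,\cdot)$ square-integrable for every $t$. For an odd integer $m$ set $$[X,m]_\varepsilon(T):=\frac1\varepsilon\int_0^T\left(X(s+\varepsilon)-X(s)\right)^m ds .$$ $X$ has zero odd $m$-th variation (also called zero $m$-th variation) on $[0,T]$ if $\lim_{\varepsilon\to0^+}[X,m]_\varepsilon(T)=0$ in $L^2(\Omega)$. *)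

(* Defs.v *)
From HB Require Import structures.
From mathcomp Require Import all_boot all_order all_algebra.
From mathcomp Require Import all_classical all_reals all_analysis.
Set Implicit Arguments.
Unset Strict Implicit.
Unset Printing Implicit Defensive.
Import Order.TTheory GRing.Theory Num.Theory.
Import numFieldNormedType.Exports.
Local Open Scope classical_set_scope.
Local Open Scope ring_scope.

Definition concave_on (R : realType) (D : set R) (f : R -> R) : Prop :=
  convex_function D (fun x => - f x).

Section Processes.
Context {R : realType} {d : measure_display} {Omega : measurableType d}.
Variable P : probability Omega R.

(* [s] is the standard deviation. The case [s = 0] is treated apart because
   [normal_prob m 0] is a uniform law in the library, not a Dirac mass. *)
Definition centered_normal (Y : Omega -> R) (s : R) : Prop :=
  forall A : set R, measurable A ->
    P (Y @^-1` A) = if s == 0 then \d_(0 : R) A else normal_prob 0 s A.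

(* Taking some of the [B i] to be [setT] gives the product rule for every
   subfamily. *)
Definition mutually_independent (n : nat) (Y : 'I_n -> Omega -> R) : Prop :=
  forall B : 'I_n -> set R, (forall i, measurable (B i)) ->
    P (\bigcap_(i in [set: 'I_n]) (Y i @^-1` B i)) =
    (\prod_(i < n) P (Y i @^-1` B i))%E.

(* Processes are indexed by [R], but only their values at times in [0, S]
   matter. *)
Definition centered_gaussian_process (S : R) (X : R -> {RV P >-> R}) : Prop :=
  forall (n : nat) (t a : 'I_n -> R), (forall i, t i \in `[0, S]) ->
    exists s : R, centered_normal (fun w => \sum_(i < n) a i * X (t i) w) s.

Definition measurable_process (S : R) (X : R -> {RV P >-> R}) : Prop :=
  measurable_fun (`[0, S] `*` [set: Omega])
    (fun p : R * Omega => X p.1 p.2).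

Definition brownian_motion (S : R) (W : R -> {RV P >-> R}) : Prop :=
  [/\ {ae P, forall w, W 0 w = 0},
      forall s t, 0 <= s -> s <= t -> t <= S ->
        centered_normal (fun w => W t w - W s w) (Num.sqrt (t - s)),
      forall (n : nat) (t : nat -> R),
        (forall i, (i <= n)%N -> t i \in `[0, S]) ->
        (forall i, (i < n)%N -> t i <= t i.+1) ->
        mutually_independent (fun (i : 'I_n) w => W (t i.+1) w - W (t i) w)
    & {ae P, forall w, {within `[0, S], continuous (fun t => W t w)}}].

(* The list of the ((a, b), c) encodes the step function
   \sum c 1_]a, b]; the intervals may overlap. *)
Definition step_code := seq ((R * R) * R).

Definition step_code_in (S : R) (phi : step_code) : Prop :=
  forall x, x \in phi -> 0 <= x.1.1 /\ x.1.1 <= x.1.2 /\ x.1.2 <= S.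

Definition step_fun (phi : step_code) (s : R) : R :=
  \sum_(x <- phi) x.2 * \1_(`]x.1.1, x.1.2]%classic : set R) s.

Definition step_integral (W : R -> {RV P >-> R}) (phi : step_code)
    (w : Omega) : R :=
  \sum_(x <- phi) x.2 * (W x.1.2 w - W x.1.1 w).

(* Y = \int_0^S f(s) dW(s) as the L^2 limit of the integrals of step functions
   converging to f in L^2([0, S]); Y is determined almost surely. *)
Definition is_wiener_integral (S : R) (W : R -> {RV P >-> R}) (f : R -> R)
    (Y : Omega -> R) : Prop :=
  exists phi : nat -> step_code,
    [/\ forall n, step_code_in S (phi n),
        (\int[lebesgue_measure]_(s in `[0%R, S])
           ((f s - step_fun (phi n) s) ^+ 2)%:E)%E @[n --> \oo] --> 0%E
      & ('E_P[(fun w => (Y w - step_integral W (phi n) w) ^+ 2)%R])%E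
          @[n --> \oo] --> 0%E].

Definition is_wiener_representation (S : R) (W : R -> {RV P >-> R})
    (G : R -> R -> R) (X : R -> {RV P >-> R}) : Prop :=
  [/\ brownian_motion S W,
      measurable_fun (`[0, S] `*` `[0, S]) (fun p : R * R => G p.1 p.2),
      forall t, t \in `[0, S] ->
        (\int[lebesgue_measure]_(s in `[0%R, S]) ((G t s) ^+ 2)%:E < +oo)%E
    & forall t, t \in `[0, S] -> is_wiener_integral S W (G t) (X t)].

Definition odd_variation (X : R -> {RV P >-> R}) (m : nat) (T e : R)
    (w : Omega) : R :=
  e^-1 * (\int[lebesgue_measure]_(s in `[0, T]) (X (s + e) w - X s w) ^+ m).

Definition has_zero_odd_variation (X : R -> {RV P >-> R}) (m : nat) (T : R)
    : Prop :=
  ('E_P[(fun w => (odd_variation X m T e w) ^+ 2)%R])%E @[e --> 0^'+] --> 0%E.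

End Processes.

(* Main.v *)
Require Import Defs.
From HB Require Import structures.
From mathcomp Require Import all_boot all_order all_algebra.
From mathcomp Require Import all_classical all_reals all_analysis.
From mathcomp Require Import measurable_realfun zify ring lra.
Import Order.TTheory GRing.Theory Num.Theory.
Import numFieldNormedType.Exports.
Local Open Scope classical_set_scope.
Local Open Scope ring_scope.
Set Implicit Arguments.
Unset Strict Implicit.
Unset Printing Implicit Defensive.

(** Write [g] for the squared metric [delta ^ 2], [Y s = X (s + e) - X s] for
    the increments, and [V e] for the second moment of the [m]-th variation of
    step [e].  The theorem follows from two bounds, valid for all small [e]:
      [c * (g (3 * e / 4) - g (e / 4)) ^ m / e <= V e <= C * g e ^ m / e].

    They come from a formula for [V e].  By Fubini ([second_moment_integral]),
    [V e] is [1 / e ^ 2] times the double integral over [0, T] of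
    [E (Y s ^ m * Y t ^ m)].  Since [(Y s, Y t)] is a centered Gaussian pair with
    common variance [g e] and covariance [incr_cov g e |t - s|], this
    expectation is a polynomial in the covariance with nonnegative coefficients
    and only odd powers ([mixed_moment]).  It depends only on [|t - s|], so that
    the double integral reduces to integrals of powers of [incr_cov g e] over
    intervals [0, v] ([integ_dist]).

    For the upper bound, one factor of each power is kept and the others are
    bounded by [g e].  By concavity [incr_cov g e] is nonpositive beyond [e],
    where it is half the difference of two consecutive increments of [g]; it
    telescopes, and the integral of its absolute value is at most [2 * e * g e]
    ([integ_norm_incr_cov]).

    The lower bound has to show that the negative covariances do not cancel the
    positive ones.  Let [D u = g (u + e) - g u].  At the distance [u + e], the
    odd powers of twice the covariance are at least [D (u + e) ^ k - D u ^ k],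
    which telescopes to no less than minus the integral of [D ^ k] over [0, e].
    On [0, e], twice the covariance is [D u + (g (e - u) - g u)]; the points [u]
    and [e - u] receive opposite perturbations of [D], and convexity of odd
    powers ([odd_pow_spread]) shows that the integral is at least that of [D ^ k], with
    a surplus when [k >= 3].  This makes all odd powers contribute nonnegative
    integrals, and the surplus of the power [m] gives the lower bound
    ([integ_incr_cov_lower]).

    Sufficiency is then immediate.  For necessity, [V e -> 0] says that
    [g (3 * r) - g r = o (r ^ (1 / m))], and summing over [r / 3, r / 9, ...]
    gives [g r = o (r ^ (1 / m))] provided that [g] tends to [0] at [0]
    ([telescope_small]).  The latter is where the representation of [X] by
    Wiener integrals enters: these span a separable subspace of [L^2], whereas a
    jump of [g] at the origin would make the [X t] uncountably many points at
    mutual distances bounded below ([wiener_process_close_times]). *)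

(** * Odd powers *)

Section PowerInequalities.
Context {R : realFieldType}.
Implicit Types (a b w x y : R) (k : nat).

Lemma exprD_superadd x y k : 0 <= x -> 0 <= y ->
  x ^+ k.+1 + y ^+ k.+1 <= (x + y) ^+ k.+1.
Proof.
move=> x0 y0; elim: k => [|k IH]; first by rewrite !expr1.
rewrite !(exprS _ k.+1).
apply: le_trans (_ : (x + y) * (x ^+ k.+1 + y ^+ k.+1) <= _); last first.
  by apply: ler_wpM2l => //; exact: addr_ge0.
have := mulr_ge0 x0 (exprn_ge0 k.+1 y0).
have := mulr_ge0 y0 (exprn_ge0 k.+1 x0).
nra.
Qed.

Lemma expr_increment_homo x y w k : 0 <= w -> 0 <= x -> x <= y ->
  (x + w) ^+ k - x ^+ k <= (y + w) ^+ k - y ^+ k.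
Proof.
move=> w0 x0 xy; have y0 := le_trans x0 xy.
elim: k => [|k IH]; first by rewrite !expr0 !subrr.
rewrite !exprS.
have e z : (z + w) * (z + w) ^+ k - z * z ^+ k
    = (z + w) * ((z + w) ^+ k - z ^+ k) + w * z ^+ k by ring.
rewrite !e; apply: lerD; last by apply: ler_wpM2l => //; exact: lerXn2r.
apply: ler_pM => //; [exact: addr_ge0| |exact: lerD].
by rewrite subr_ge0 lerXn2r// ?nnegrE ?addr_ge0// lerDl.
Qed.

Lemma expr_second_difference x w k : 0 <= w -> w <= x ->
  2 * x ^+ k.+2 + w ^+ k.+2 <= (x + w) ^+ k.+2 + (x - w) ^+ k.+2.
Proof.
move=> w0 wx; have x0 := le_trans w0 wx.
elim: k => [|k IH]; first by rewrite !expr2; nra.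
rewrite !(exprS _ k.+2).
have h1 : x * (2 * x ^+ k.+2 + w ^+ k.+2)
    <= x * ((x + w) ^+ k.+2 + (x - w) ^+ k.+2) by exact: ler_wpM2l.
have h2 : 0 <= w * ((x + w) ^+ k.+2 - (x - w) ^+ k.+2).
  apply: mulr_ge0 => //; rewrite subr_ge0; apply: lerXn2r.
  - by rewrite nnegrE subr_ge0.
  - by rewrite nnegrE addr_ge0.
  - lra.
have h3 : w * w ^+ k.+2 <= x * w ^+ k.+2.
  by apply: ler_wpM2r => //; exact: exprn_ge0.
nra.
Qed.

(** Convexity of [x ^+ k] on the nonnegative half-line rewards moving mass [w]
    from the smaller [b] to the larger [a]; since the power is odd, this
    persists when [b - w] becomes negative.  For [k >= 3] the convexity is
    strict enough for a gain of [w ^+ k]. *)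
Lemma odd_pow_spread a b w k : odd k -> 0 <= b -> b <= a -> 0 <= w -> w <= a ->
  a ^+ k + b ^+ k + (1 < k)%:R * w ^+ k <= (a + w) ^+ k + (b - w) ^+ k.
Proof.
move=> ok b0 ba w0 wa; have a0 := le_trans b0 ba.
case: k ok => [//|[|k]] ok; first by rewrite !expr1 mul0r; lra.
rewrite mul1r.
have [bw|wb] := leP b w.
  have h1 := @exprD_superadd (w - b) b k.+1 ltac:(lra) b0.
  rewrite subrK in h1.
  have -> : b - w = - (w - b) by ring.
  rewrite exprNn -signr_odd ok expr1 mulN1r.
  have h2 : a ^+ k.+2 + 2 * w ^+ k.+2 <= (a + w) ^+ k.+2.
    have h := ler_wpM2l (addr_ge0 a0 w0) (@exprD_superadd a w k a0 w0).
    rewrite !(exprS _ k.+1).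
    have h3 : w * w ^+ k.+1 <= a * w ^+ k.+1.
      by apply: ler_wpM2r => //; exact: exprn_ge0.
    have h4 : 0 <= w * a ^+ k.+1 by rewrite mulr_ge0 ?exprn_ge0.
    nra.
  lra.
have := @expr_second_difference b w k w0 (ltW wb).
have := @expr_increment_homo b a w k.+2 w0 b0 ba.
lra.
Qed.

End PowerInequalities.

(** * Lebesgue integrals of bounded functions *)

Section AffineChange.
Context {R : realType}.
Local Notation mu := (@lebesgue_measure R).
Local Notation aff a b := (fun x : R => a * x + b : measurableTypeR R).

Lemma measurable_affine (a b : R) :
  measurable_fun [set: measurableTypeR R] (aff a b).
Proof. by apply: measurable_funD => //; exact: mulrl_measurable. Qed.

(** Both sides are measures, so it suffices to compare them on half-open
    intervals. *)
Lemma lebesgue_measure_affine (a b : R) (A : set R) : 0 < a -> measurable A ->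
  (a%:E * pushforward mu (aff a b) A = mu A)%E.
Proof.
move=> a0 mA.
have ma := measurable_affine a b.
have [nu nuE] : exists nu : {measure set (measurableTypeR R) -> \bar R},
    forall B, nu B = (a%:E * mu (aff a b @^-1` B))%E.
  by unshelve eexists (mscale (NngNum (ltW a0)) (pushforward mu (aff a b))).
rewrite -[LHS]nuE; apply/esym/lebesgue_measure_unique => // _ [[x y]] _ <-.
rewrite nuE.
have -> : aff a b @^-1` [set` `]x, y]] = [set` `](x - b) / a, (y - b) / a]].
  apply/seteqP; split => z /=; rewrite !in_itv/= ltr_pdivrMr// ler_pdivlMr//;
  move=> /andP[u v]; apply/andP; split; lra.
rewrite !lebesgue_measure_itv/= !lte_fin ltr_pM2r ?invr_gt0// ltrD2r.
case: ifPn => _; last by rewrite mule0.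
rewrite -!EFinD -EFinM; congr EFin.
by field; rewrite gt_eqF.
Qed.

Lemma ge0_integral_affine (a b : R) (f : R -> \bar R) : 0 < a ->
  measurable_fun [set: R] f -> (forall x, 0 <= f x)%E ->
  (\int[mu]_x f x = a%:E * \int[mu]_x f (a * x + b)%R)%E.
Proof.
move=> a0 mf f0.
have ma := measurable_affine a b.
have E : (\int[pushforward mu (aff a b)]_x f x = \int[mu]_x f (a * x + b)%R)%E.
  by rewrite (ge0_integral_pushforward ma)// => x _; exact: f0.
rewrite -E -[X in (X%:E * _)%E]/((NngNum (ltW a0))%:num).
rewrite -ge0_integral_mscale//.
by apply: eq_measure_integral => A mA _; exact/esym/lebesgue_measure_affine.
Qed.

End AffineChange.

Section BoundedMeasurable.
Context {R : realType}.
Local Notation mu := (@lebesgue_measure R).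
Implicit Types (f g : R -> R) (a b c : R).

Definition bounded_measurable f :=
  measurable_fun [set: R] f /\ exists M, forall x, `|f x| <= M.

Lemma bm_cst c : bounded_measurable (fun=> c).
Proof. by split; [exact: measurable_cst|exists `|c|]. Qed.

Lemma bmD f g : bounded_measurable f -> bounded_measurable g ->
  bounded_measurable (fun x => f x + g x).
Proof.
move=> [mf [M hM]] [mg [N hN]]; split; first exact: measurable_funD.
exists (M + N) => x; exact: le_trans (ler_normD _ _) (lerD (hM x) (hN x)).
Qed.

Lemma bmM f g : bounded_measurable f -> bounded_measurable g ->
  bounded_measurable (fun x => f x * g x).
Proof.
move=> [mf [M hM]] [mg [N hN]]; split; first exact: measurable_funM.
by exists (M * N) => x; rewrite normrM ler_pM.
Qed.

Lemma bmN f : bounded_measurable f -> bounded_measurable (fun x => - f x).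
Proof.
move=> bf; have := bmM (bm_cst (-1)) bf.
by congr bounded_measurable; apply/funext => x; rewrite mulN1r.
Qed.

Lemma bmB f g : bounded_measurable f -> bounded_measurable g ->
  bounded_measurable (fun x => f x - g x).
Proof. by move=> bf bg; apply: bmD => //; exact: bmN. Qed.

Lemma bmX f k : bounded_measurable f -> bounded_measurable (fun x => f x ^+ k).
Proof.
move=> bf; elim: k => [|k IH]; first exact: bm_cst.
have := bmM bf IH.
by congr bounded_measurable; apply/funext => x; rewrite exprS.
Qed.

Lemma bm_norm f : bounded_measurable f -> bounded_measurable (fun x => `|f x|).
Proof.
move=> [mf [M hM]]; split; first exact: measurableT_comp.
by exists M => x; rewrite normr_id.
Qed.

Lemma bm_sum n (F : 'I_n -> R -> R) : (forall i, bounded_measurable (F i)) ->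
  bounded_measurable (fun x => \sum_(i < n) F i x).
Proof.
move=> hF; elim: n F hF => [|n IH] F hF.
  have := bm_cst 0; congr bounded_measurable.
  by apply/funext => x; rewrite big_ord0.
have := bmD (IH _ (fun i => hF (widen_ord (leqnSn n) i))) (hF ord_max).
by congr bounded_measurable; apply/funext => x; rewrite big_ord_recr.
Qed.

Lemma bm_comp f (h : R -> R) : bounded_measurable f -> measurable_fun setT h ->
  bounded_measurable (fun x => f (h x)).
Proof.
by move=> [mf [M hM]] mh; split; [exact: measurableT_comp|exists M => x].
Qed.

Lemma bm_integrable f a b : bounded_measurable f ->
  mu.-integrable `[a, b] (EFin \o f).
Proof.
move=> [mf [M hM]]; apply: measurable_bounded_integrable => //.
- have := lebesgue_measure_itv `[a, b]; rewrite /= => ->; case: ifP => _ //.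
  by rewrite -EFinD ltry.
- exact: measurable_funTS.
- by exists M; split; [rewrite num_real|move=> y My x _ /=;
    rewrite (le_trans (hM x))// ltW].
Qed.

Definition integ a b f := \int[mu]_(x in `[a, b]) f x.

Lemma EFin_integ f a b : bounded_measurable f ->
  ((integ a b f)%:E = \int[mu]_(x in `[a, b]) (f x)%:E)%E.
Proof.
move=> bf; rewrite /integ /Rintegral fineK//.
by apply: integrable_fin_num => //; exact: bm_integrable.
Qed.

Lemma eq_integ a b f g : (forall x, a <= x -> x <= b -> f x = g x) ->
  integ a b f = integ a b g.
Proof.
move=> fg; apply: eq_Rintegral => x; rewrite inE/= in_itv/= => /andP[? ?].
exact: fg.
Qed.

Lemma integ_le a b f g : bounded_measurable f -> bounded_measurable g ->
  (forall x, a <= x -> x <= b -> f x <= g x) -> integ a b f <= integ a b g.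
Proof.
move=> bf bg fg; apply: le_Rintegral => //; try exact: bm_integrable.
by move=> x /=; rewrite in_itv/= => /andP[? ?]; exact: fg.
Qed.

Lemma integ_ge0 a b f : (forall x, a <= x -> x <= b -> 0 <= f x) ->
  0 <= integ a b f.
Proof.
move=> f0; apply: Rintegral_ge0 => x /=; rewrite in_itv/= => /andP[? ?].
exact: f0.
Qed.

Lemma integD a b f g : bounded_measurable f -> bounded_measurable g ->
  integ a b (fun x => f x + g x) = integ a b f + integ a b g.
Proof. by move=> bf bg; apply: RintegralD => //; exact: bm_integrable. Qed.

Lemma integB a b f g : bounded_measurable f -> bounded_measurable g ->
  integ a b (fun x => f x - g x) = integ a b f - integ a b g.
Proof. by move=> bf bg; apply: RintegralB => //; exact: bm_integrable. Qed.

Lemma integZ a b c f : bounded_measurable f ->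
  integ a b (fun x => c * f x) = c * integ a b f.
Proof. by move=> bf; apply: RintegralZl => //; exact: bm_integrable. Qed.

Lemma integ_sum a b n (F : 'I_n -> R -> R) :
  (forall i, bounded_measurable (F i)) ->
  integ a b (fun x => \sum_(i < n) F i x) = \sum_(i < n) integ a b (F i).
Proof.
move=> hF; elim: n F hF => [|n IH] F hF.
  rewrite big_ord0 (@eq_integ _ _ _ (fun=> 0)); last by move=> *; rewrite big_ord0.
  by rewrite /integ Rintegral_cst// mul0r.
rewrite big_ord_recr/= -IH// -integD//; last exact: bm_sum.
by apply: eq_integ => x _ _; rewrite big_ord_recr.
Qed.

Lemma integ_norm a b f : bounded_measurable f ->
  `|integ a b f| <= integ a b (fun x => `|f x|).
Proof. by move=> bf; apply: le_normr_Rintegral => //; exact: bm_integrable. Qed.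

Lemma integ_cst a b c : a <= b -> integ a b (fun=> c) = (b - a) * c.
Proof.
move=> ab; rewrite /integ Rintegral_cst// mulrC; congr (_ * _).
have := lebesgue_measure_itv `[a, b]; rewrite /= lte_fin => ->.
case: ltP => //= ba; have -> : a = b by apply/eqP; rewrite eq_le ab.
by rewrite subrr.
Qed.

Lemma integ_split c a b f : bounded_measurable f -> a <= c -> c <= b ->
  integ a b f = integ a c f + integ c b f.
Proof.
move=> bf ac cb; have /= := @Rintegral_itvB _ f (BLeft a) (BRight b) c
  (bm_integrable a b bf).
rewrite /= !bnd_simp => /(_ ac cb).
rewrite Rintegral_itv_obnd_cbnd; last first.
  apply: integrableS (bm_integrable c b bf) => //.
  by apply: subset_itvr; rewrite bnd_simp.
by rewrite /integ => <-; rewrite addrC subrK.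
Qed.

Lemma integ_shift a b c f : bounded_measurable f ->
  integ a b (fun x => f (x + c)) = integ (a + c) (b + c) f.
Proof.
move=> bf; rewrite /integ /Rintegral; congr fine.
have mc := measurable_affine 1 c.
have E : (fun x : R => 1 * x + c) @^-1` `[a + c, b + c] = `[a, b]%classic.
  by apply/seteqP; split => z /=; rewrite !in_itv/= => /andP[u v];
    apply/andP; split; lra.
transitivity (\int[pushforward mu (fun x : R => (1 * x + c)%R : measurableTypeR R)]_(x in
   `[(a + c)%R, (b + c)%R]) (f x)%:E)%E; last first.
  apply: eq_measure_integral => A mA _.
  by rewrite -[RHS](lebesgue_measure_affine c ltr01 mA) mul1e.
rewrite integral_pushforward//=.
- by rewrite E; apply: eq_integral => x _ /=; rewrite mul1r.
- by apply/measurable_EFinP; case: bf.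
- rewrite E; apply: bm_integrable.
  by apply: (bm_comp (h := fun x => 1 * x + c)).
Qed.

Lemma integ_opp a b f : bounded_measurable f ->
  integ a b (fun x => f (- x)) = integ (- b) (- a) f.
Proof.
move=> bf; rewrite /integ /Rintegral; congr fine.
have mN : measurable_fun [set: measurableTypeR R] (-%R : R -> measurableTypeR R).
  exact: oppr_measurable.
have E : (-%R : R -> R) @^-1` `[- b, - a] = `[a, b]%classic.
  by rewrite opp_preimage_itvbndbnd/= !opprK.
transitivity (\int[pushforward mu (-%R : R -> measurableTypeR R)]_(x in
   `[(- b)%R, (- a)%R]) (f x)%:E)%E; last first.
  by apply: eq_measure_integral => A mA _; exact: lebesgue_measureN.
rewrite integral_pushforward//=.
- by rewrite E.
- by apply/measurable_EFinP; case: bf.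
- by rewrite E; apply: bm_integrable; exact: bm_comp.
Qed.

Lemma integ_reflect a b c f : bounded_measurable f ->
  integ a b (fun x => f (c - x)) = integ (c - b) (c - a) f.
Proof.
move=> bf.
rewrite (@eq_integ _ _ _ (fun x => (fun y => f (y + c)) (- x))); last first.
  by move=> x _ _; rewrite addrC.
rewrite (integ_opp _ _ (f := fun y => f (y + c))); last first.
  by apply: bm_comp => //; exact: measurable_funD.
by rewrite integ_shift// ![_ + c]addrC.
Qed.

End BoundedMeasurable.

(** * The covariance of increments of a concave metric *)

Section IncrementCovariance.
Context {R : realType}.
Implicit Types (g : R -> R) (e u v y : R) (k : nat).

Lemma ler_odd_expr k (x y : R) : odd k -> x <= y -> x ^+ k <= y ^+ k.
Proof.
move=> ok xy; have k0 : k != 0%N by case: k ok.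
have [x0|x0] := leP 0 x; first by rewrite lerXn2r// nnegrE (le_trans x0).
have oE (z : R) : z ^+ k = - (- z) ^+ k by rewrite exprNn -signr_odd ok expr1 mulN1r opprK.
have [y0|y0] := leP 0 y.
  rewrite (@le_trans _ _ 0)// ?exprn_ge0//.
  by rewrite oE oppr_le0 exprn_ge0// oppr_ge0 ltW.
by rewrite (oE x) (oE y) lerN2 lerXn2r ?nnegrE ?oppr_ge0 ?lerN2// ltW.
Qed.

(** With [g] the squared canonical metric, [incr_cov g e u] is the covariance of
    the increments of length [e] starting at times at distance [u]. *)
Definition incr_cov g e u : R := (g (u + e) + g `|u - e| - 2 * g u) / 2.

Variables (g : R -> R) (S e : R).
Hypothesis g_homo : {homo g : x y / x <= y}.
Hypothesis g_bm : bounded_measurable g.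
Hypothesis g0 : g 0 = 0.
Hypothesis g_concave : forall x y h, 0 <= x -> x <= y -> 0 <= h -> y + h <= S ->
  g (y + h) - g y <= g (x + h) - g x.
Hypothesis e_gt0 : 0 < e.
Hypothesis e2S : e + e <= S.

Let D u := g (u + e) - g u.
(* twice [incr_cov g e] *)
Let p u := g (u + e) + g `|u - e| - 2 * g u.

Let g_ge0 x : 0 <= x -> 0 <= g x.
Proof. by move=> x0; rewrite -g0; exact: g_homo. Qed.

Let D_ge0 u : 0 <= D u.
Proof. by rewrite subr_ge0 g_homo// lerDl ltW. Qed.

Let D_le u : 0 <= u -> u + e <= S -> D u <= g e.
Proof.
move=> u0 ue; have := g_concave (lexx 0) u0 (ltW e_gt0) ue.
by rewrite add0r g0 subr0.
Qed.

Let bm_D : bounded_measurable D.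
Proof.
apply: bmB => //; apply: bm_comp => //.
exact: measurable_funD.
Qed.

Let bm_p : bounded_measurable p.
Proof.
apply: bmB; last by apply: bmM => //; exact: bm_cst.
apply: bmD; apply: bm_comp => //; first exact: measurable_funD.
by apply: measurableT_comp => //; exact: measurable_funB.
Qed.

Lemma bm_incr_cov : bounded_measurable (incr_cov g e).
Proof. by apply: bmM => //; exact: bm_cst. Qed.

Let p_near u : u <= e -> p u = D u + (g (e - u) - g u).
Proof.
by move=> ue; rewrite /p /D (distrC u e) ger0_norm ?subr_ge0//; ring.
Qed.

Let p_far u : 0 <= u -> p (u + e) = - (D u - D (u + e)).
Proof.
by move=> u0; rewrite /p /D addrK ger0_norm//; ring.
Qed.

Section Powers.
Variables (k : nat) (k_odd : odd k).
(* Subtracting [D u ^+ k] is harmless, since its integrals telescope against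
   the part of [p ^+ k] beyond [e]. *)
Let f u := p u ^+ k - D u ^+ k.

Let bm_f : bounded_measurable f.
Proof. by apply: bmB; exact: bmX. Qed.

Let f_left u : u <= e / 2 -> 0 <= f u.
Proof.
move=> ue; have e0 := e_gt0; rewrite /f subr_ge0; apply: ler_odd_expr => //.
rewrite p_near; last lra.
by rewrite lerDl subr_ge0; apply: g_homo; lra.
Qed.

Let f_right u : e / 2 <= u -> u <= e -> f u <= 0.
Proof.
move=> eu ue; have e0 := e_gt0; rewrite /f subr_le0; apply: ler_odd_expr => //.
rewrite p_near; last lra.
by rewrite gerDl subr_le0; apply: g_homo; lra.
Qed.

(* The reflection [y |-> e - y] pairs the half of [0, e] where the covariance
   can be negative with the half where it is nonnegative. *)
Let f_pair y : 0 <= y -> y <= e / 2 ->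
  (1 < k)%:R * (g (e - y) - g y) ^+ k <= f y + f (e - y).
Proof.
move=> y0 ye; have [e0 eS] := (e_gt0, e2S); rewrite /f p_near; last lra.
have -> : p (e - y) = D (e - y) - (g (e - y) - g y).
  rewrite p_near; last lra.
  by rewrite subKr; ring.
have := @odd_pow_spread _ (D y) (D (e - y)) (g (e - y) - g y) k k_odd
  (D_ge0 _) _ _ _.
have h1 : D (e - y) <= D y.
  by apply: g_concave => //; [lra|exact: ltW|lra].
have h2 : 0 <= g (e - y) - g y by rewrite subr_ge0; apply: g_homo; lra.
have h3 : g (e - y) - g y <= D y by rewrite lerD2r; apply: g_homo; lra.
move=> /(_ h1 h2 h3); lra.
Qed.

Let slack := (1 < k)%:R * (e / 4 * (g (3 * e / 4) - g (e / 4)) ^+ k).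

Let slack_ge0 : 0 <= slack.
Proof.
rewrite mulr_ge0// mulr_ge0 ?divr_ge0 ?(ltW e_gt0)//.
by rewrite exprn_ge0// subr_ge0; apply: g_homo; have := e_gt0; lra.
Qed.

Let integ_f : slack <= integ 0 e f.
Proof.
have e0 := e_gt0.
have mB : measurable_fun [set: R] (fun x => e - x) by exact: measurable_funB.
have bm_fr : bounded_measurable (fun x => f (e - x)) by exact: bm_comp.
have bm_w : bounded_measurable (fun y => g (e - y) - g y).
  by apply: bmB => //; exact: bm_comp.
rewrite (integ_split (c := e / 2))//; try lra.
have <- : integ 0 (e / 2) (fun x => f (e - x)) = integ (e / 2) e f.
  rewrite integ_reflect// subr0.
  by have -> : e - e / 2 = e / 2 by lra.
rewrite -integD//.
have bm_l : bounded_measurable (fun y => (1 < k)%:R * (g (e - y) - g y) ^+ k).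
  by apply: bmM; [exact: bm_cst|exact: bmX].
apply: le_trans (_ : integ 0 (e / 2)
    (fun y => (1 < k)%:R * (g (e - y) - g y) ^+ k) <= _); last first.
  apply: integ_le; [exact: bm_l|exact: bmD|].
  by move=> x x0 xe; exact: f_pair.
rewrite (integ_split (c := e / 4))//; try lra.
rewrite -[slack]addr0; apply: lerD; last first.
  apply: integ_ge0 => x x0 xe; rewrite mulr_ge0// exprn_ge0// subr_ge0.
  by apply: g_homo; lra.
apply: le_trans (_ : integ 0 (e / 4)
    (fun y => (1 < k)%:R * (g (3 * e / 4) - g (e / 4)) ^+ k) <= _).
  rewrite integ_cst; last lra.
  by rewrite subr0 /slack mulrCA.
apply: integ_le => //; first exact: bm_cst.
move=> x x0 xe; apply: ler_wpM2l => //; apply: ler_odd_expr => //.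
by apply: lerB; apply: g_homo; lra.
Qed.

Let integ_p_near v : 0 <= v -> v <= e -> 0 <= integ 0 v (fun u => p u ^+ k).
Proof.
move=> v0 ve.
apply: (@le_trans _ _ (integ 0 v f)).
  have [v2|v2] := leP v (e / 2).
    by apply: integ_ge0 => x x0 xv; apply: f_left; lra.
  apply: (le_trans slack_ge0); apply: (le_trans integ_f).
  rewrite (integ_split (c := v))// gerDl -oppr_ge0 -mulN1r -integZ//.
  apply: integ_ge0 => x vx xe; rewrite mulN1r oppr_ge0; apply: f_right => //.
  lra.
apply: integ_le => //; first exact: bmX.
by move=> x _ _; rewrite /f gerBl exprn_ge0.
Qed.

Let integ_p_far v : e <= v -> v + e <= S ->
  slack <= integ 0 v (fun u => p u ^+ k).
Proof.
move=> ev vS; have e0 := e_gt0.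
have mD : measurable_fun [set: R] (fun x => x + e) by exact: measurable_funD.
have bpk : bounded_measurable (fun u => p u ^+ k) by exact: bmX.
have bDk : bounded_measurable (fun u => D u ^+ k) by exact: bmX.
have bDke : bounded_measurable (fun u => D (u + e) ^+ k).
  by apply: bmX; apply: (bm_comp (f := D)).
rewrite (integ_split (c := e))//; try lra.
have hn : integ 0 e (fun u => p u ^+ k) = integ 0 e f + integ 0 e (fun u => D u ^+ k).
  by rewrite -integD//; apply: eq_integ => x _ _; rewrite /f subrK.
have hf : integ e v (fun u => p u ^+ k)
    = integ 0 (v - e) (fun u => p (u + e) ^+ k).
  by rewrite (integ_shift _ _ _ (f := fun u => p u ^+ k))// add0r subrK.
have hfar : integ e v (fun u => D u ^+ k) - integ 0 (v - e) (fun u => D u ^+ k)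
    <= integ e v (fun u => p u ^+ k).
  rewrite hf -[X in integ X v]add0r -[X in integ _ X (fun u => D u ^+ k)](subrK e v).
  rewrite -(integ_shift _ _ _ (f := fun u => D u ^+ k))//.
  rewrite -integB//; apply: integ_le.
  - exact: bmB.
  - by apply: (bm_comp (f := fun u => p u ^+ k)).
  - move=> x x0 xv; rewrite p_far//.
    rewrite exprNn -signr_odd k_odd expr1 mulN1r.
    have De : D (x + e) <= D x by apply: g_concave => //; lra.
    case: (k) k_odd => // j _.
    have := @exprD_superadd _ (D x - D (x + e)) (D (x + e)) j _ (D_ge0 _).
    rewrite subrK subr_ge0 => /(_ De); lra.
have h0 : integ 0 v (fun u => D u ^+ k)
    = integ 0 e (fun u => D u ^+ k) + integ e v (fun u => D u ^+ k).
  by apply: integ_split => //; lra.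
have h1 : integ 0 v (fun u => D u ^+ k)
    = integ 0 (v - e) (fun u => D u ^+ k) + integ (v - e) v (fun u => D u ^+ k).
  by apply: integ_split => //; lra.
have h2 : 0 <= integ (v - e) v (fun u => D u ^+ k).
  by apply: integ_ge0 => x _ _; rewrite exprn_ge0.
have := integ_f; rewrite hn; lra.
Qed.

Let integ_covE v : integ 0 v (fun u => incr_cov g e u ^+ k)
  = 2^-1 ^+ k * integ 0 v (fun u => p u ^+ k).
Proof.
rewrite -integZ; last exact: bmX.
by apply: eq_integ => x _ _; rewrite /incr_cov exprMn mulrC.
Qed.

Lemma integ_incr_cov_ge0 v : 0 <= v -> v + e <= S ->
  0 <= integ 0 v (fun u => incr_cov g e u ^+ k).
Proof.
move=> v0 vS; rewrite integ_covE mulr_ge0 ?exprn_ge0//.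
have [ve|ve] := leP v e; first exact: integ_p_near.
exact: le_trans slack_ge0 (integ_p_far (ltW ve) vS).
Qed.

(** For [k = 1] the negative part of the covariance may cancel the positive
    part completely.  Higher odd powers damp the negative part more, since it
    never exceeds half of the peak. *)
Lemma integ_incr_cov_lower v : (1 < k)%N -> e <= v -> v + e <= S ->
  2^-1 ^+ k * (e / 4 * (g (3 * e / 4) - g (e / 4)) ^+ k)
    <= integ 0 v (fun u => incr_cov g e u ^+ k).
Proof.
move=> k1 ev vS; rewrite integ_covE ler_wpM2l ?exprn_ge0//.
by have := integ_p_far ev vS; rewrite /slack k1 mul1r.
Qed.

End Powers.

Let p_near_le u : 0 <= u -> u <= e -> `|p u| <= 2 * g e.
Proof.
move=> u0 ue; have [e0 eS] := (e_gt0, e2S); rewrite p_near//.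
have h1 := D_ge0 u; have h2 : D u <= g e by apply: D_le => //; lra.
have h3 : g (e - u) <= g e by apply: g_homo; lra.
have h4 : g u <= g e by exact: g_homo.
have h5 := g_ge0 u0; have h6 : 0 <= g (e - u) by apply: g_ge0; lra.
rewrite ler_norml; apply/andP; split; lra.
Qed.

Let p_far_le u : 0 <= u -> u + e + e <= S ->
  `|p (u + e)| = D u - D (u + e).
Proof.
move=> u0 ue; rewrite p_far// normrN ger0_norm// subr_ge0.
by apply: g_concave => //; have := e_gt0; lra.
Qed.

Lemma incr_cov_le u : 0 <= u -> u + e <= S -> `|incr_cov g e u| <= g e.
Proof.
move=> u0 ue; have e0 := e_gt0.
rewrite /incr_cov -/(p u) normrM (ger0_norm (x := 2^-1))// ler_pdivrMr// mulrC.
have [ue'|ue'] := leP u e; first exact: p_near_le.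
have -> : u = u - e + e by rewrite subrK.
rewrite p_far_le; try lra.
have := D_ge0 (u - e + e); have : D (u - e) <= g e by apply: D_le; lra.
have : 0 <= g e by apply: g_ge0; exact: ltW.
lra.
Qed.

(** On [0, e] the pointwise bound suffices; beyond [e] the covariance has a
    constant sign and telescopes. *)
Lemma integ_norm_incr_cov v : 0 <= v -> v + e <= S ->
  integ 0 v (fun u => `|incr_cov g e u|) <= 2 * e * g e.
Proof.
move=> v0 vS; have e0 := e_gt0.
have ge0 : 0 <= g e by apply: g_ge0; exact: ltW.
have bmp : bounded_measurable (fun u => `|p u|) by exact: bm_norm.
have mD : measurable_fun [set: R] (fun x => x + e) by exact: measurable_funD.
have -> : integ 0 v (fun u => `|incr_cov g e u|)
    = 2^-1 * integ 0 v (fun u => `|p u|).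
  rewrite -integZ//; apply: eq_integ => x _ _.
  by rewrite /incr_cov -/(p x) normrM mulrC (ger0_norm (x := 2^-1)).
suff : integ 0 v (fun u => `|p u|) <= 3 * e * g e.
  have : 0 <= e * g e by rewrite mulr_ge0// ltW.
  nra.
have near_le w : 0 <= w -> w <= e ->
    integ 0 w (fun u => `|p u|) <= w * (2 * g e).
  move=> w0 we; rewrite -[X in _ <= X * _]subr0 -integ_cst//.
  apply: integ_le => //; first exact: bm_cst.
  by move=> x x0 xw; apply: p_near_le => //; lra.
have [ve|ve] := leP v e.
  by apply: (le_trans (near_le _ v0 ve)); nra.
rewrite (integ_split (c := e))//; try exact: ltW.
have hf : integ e v (fun u => `|p u|)
    = integ 0 (v - e) D - integ e v D.
  have -> : integ e v (fun u => `|p u|) = integ 0 (v - e) (fun u => `|p (u + e)|).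
    by rewrite (integ_shift _ _ _ (f := fun u => `|p u|))// add0r subrK.
  have -> : integ e v D = integ 0 (v - e) (fun u => D (u + e)).
    by rewrite (integ_shift _ _ _ (f := D))// add0r subrK.
  rewrite -integB//; last exact: (bm_comp (f := D)).
  by apply: eq_integ => x x0 xv; rewrite p_far_le//; lra.
have h0 : integ 0 v D = integ 0 e D + integ e v D.
  by apply: integ_split => //; lra.
have h1 : integ 0 v D = integ 0 (v - e) D + integ (v - e) v D.
  by apply: integ_split => //; lra.
have h2 : 0 <= integ (v - e) v D by apply: integ_ge0.
have h3 : integ 0 e D <= e * g e.
  rewrite -[X in _ <= X * _]subr0 -integ_cst; last exact: ltW.
  apply: integ_le => //; first exact: bm_cst.
  by move=> x x0 xe; apply: D_le => //; lra.
have := near_le _ (ltW e0) (lexx e).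
rewrite hf; lra.
Qed.

End IncrementCovariance.

(** * Gaussian moments *)

Section Density.
Local Open Scope ereal_scope.
Context d (T : measurableType d) (R : realType).
Variables (mu nu : {measure set T -> \bar R}) (p : T -> R).
Hypothesis p_ge0 : forall x, (0 <= p x)%R.
Hypothesis mp : measurable_fun setT p.
Hypothesis nuE : forall A, measurable A -> nu A = \int[mu]_(x in A) (p x)%:E.

Import HBNNSimple.

(** By approximation with nonnegative simple functions and monotone
    convergence. *)
Lemma ge0_integral_density (f : T -> \bar R) :
  measurable_fun setT f -> (forall x, 0 <= f x) ->
  \int[nu]_x f x = \int[mu]_x (f x * (p x)%:E).
Proof.
move=> mf f0; pose f_ := nnsfun_approx measurableT mf.
have mp' : measurable_fun setT (EFin \o p) by exact/measurable_EFinP.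
transitivity (limn (fun n => \int[nu]_x (f_ n x)%:E)).
  rewrite -monotone_convergence//.
  - apply: eq_integral => y _; apply/esym/cvg_lim => //.
    by apply: cvg_nnsfun_approx=> // *; exact: f0.
  - by move=> n; exact/measurable_EFinP/measurable_funP.
  - by move=> n y _; rewrite lee_fin.
  - by move=> y _ m n mn; rewrite lee_fin; exact/lefP/nd_nnsfun_approx.
rewrite [X in limn X](_ : _ = (fun n => \int[mu]_x ((f_ n x)%:E * (p x)%:E))).
  rewrite -monotone_convergence//; last 3 first.
    - by move=> n; apply: emeasurable_funM => //; exact/measurable_EFinP.
    - by move=> n x _; rewrite -EFinM lee_fin mulr_ge0.
    - move=> x _ m n mn; rewrite -!EFinM lee_fin ler_wpM2r//.
      exact/lefP/nd_nnsfun_approx.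
  apply: eq_integral => x _; apply/cvg_lim => //.
  apply: cvgeZr => //.
  by apply: cvg_nnsfun_approx=> // *; exact: f0.
apply/funext => n.
transitivity (\sum_(k \in range (f_ n))
    \int[nu]_x (k * \1_(f_ n @^-1` [set k]) x)%:E).
  under eq_integral do rewrite fimfunE -fsumEFin//.
  rewrite ge0_integral_fsum//.
  - by move=> r; exact/measurable_EFinP/measurable_funM.
  - by move=> r x _; rewrite nnfun_muleindic_ge0.
transitivity (\sum_(k \in range (f_ n))
    \int[mu]_x ((k * \1_(f_ n @^-1` [set k]) x)%:E * (p x)%:E)); last first.
  rewrite -ge0_integral_fsum//.
  - apply: eq_integral => x _; rewrite -ge0_mule_fsuml.
      by rewrite [in RHS]fimfunE -fsumEFin.
    by move=> r; rewrite EFinM nnfun_muleindic_ge0.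
  - move=> r; apply: emeasurable_funM => //.
    exact/measurable_EFinP/measurable_funM.
  - by move=> r x _; rewrite mule_ge0 ?lee_fin// -lee_fin EFinM nnfun_muleindic_ge0.
apply: eq_fsbigr => r /set_mem [x _ <-].
set A := _ @^-1` _.
have mA : measurable A by exact: measurable_funPTI.
have k0 : (0 <= f_ n x)%R by [].
under eq_integral do rewrite EFinM.
rewrite ge0_integralZl//; last exact/measurable_EFinP.
rewrite integral_indic// setIT.
under [RHS]eq_integral do rewrite EFinM -muleA.
rewrite [RHS]ge0_integralZl//.
- congr (_ * _); rewrite nuE// integral_mkcond; apply: eq_integral => y _.
  by rewrite patchE indicE; case: (y \in A); rewrite ?mul1e ?mul0e.
- by apply: emeasurable_funM => //; exact/measurable_EFinP.
- by move=> y _; rewrite -EFinM lee_fin mulr_ge0.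
Qed.

End Density.

Section GaussianMoments.
Context {R : realType}.
Local Notation mu := (@lebesgue_measure R).
Local Notation scale s := (fun x : R => s * x : measurableTypeR R).

Lemma normal_prob_scale (s : R) (A : set R) : s != 0 -> measurable A ->
  normal_prob 0 s A = normal_prob 0 1 (scale `|s| @^-1` A).
Proof.
move=> s0 mA; rewrite /normal_prob integral_mkcond [RHS]integral_mkcond.
have sgt0 : 0 < `|s| by rewrite normr_gt0.
have mp : measurable_fun [set: R] (fun x => (normal_pdf 0 s x)%:E).
  by apply/measurable_EFinP; exact: measurable_normal_pdf.
rewrite (ge0_integral_affine 0 sgt0).
- rewrite -ge0_integralZl//.
  + apply: eq_integral => x _; rewrite !patchE addr0.
    have -> : ((`|s| * x) \in A) = (x \in scale `|s| @^-1` A).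
      by apply/idP/idP; rewrite !inE.
    case: ifP => _; last by rewrite mule0.
    rewrite -EFinM /normal_pdf (negbTE s0) oner_eq0; congr EFin.
    rewrite /normal_fun !subr0 /normal_peak.
    have -> : s ^+ 2 = `|s| ^+ 2 by rewrite real_normK// num_real.
    rewrite mulrA; congr (_ * _).
      rewrite expr1n mul1r -mulrnAr sqrtrM ?exprn_ge0// sqrtr_sqr normr_id.
      by rewrite invfM mulrA divff ?mul1r// gt_eqF.
    congr expR; rewrite expr1n exprMn.
    by field; rewrite gt_eqF.
  + apply: (measurableT_comp (f := (fun x => (normal_pdf 0 s x)%:E) \_ A)).
      by apply/(measurable_restrictT _ mA); exact: measurable_funTS.
    exact: measurable_affine.
  + move=> x _; rewrite patchE; case: ifP => //.
    by rewrite lee_fin normal_pdf_ge0.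
- by apply/(measurable_restrictT _ mA); exact: measurable_funTS.
- move=> x; rewrite patchE; case: ifP => //.
  by rewrite lee_fin normal_pdf_ge0.
Qed.

Definition gauss_moment (n : nat) : R :=
  fine (\int[normal_prob 0 1]_x ((x ^+ n.*2)%:E : \bar R)).

Let even_pow_ge0 n (x : R) : 0 <= x ^+ n.*2.
Proof. by rewrite -mul2n exprM exprn_ge0// sqr_ge0. Qed.

Lemma gauss_moment_fin n :
  (\int[normal_prob 0 1]_x ((x ^+ n.*2)%:E : \bar R) < +oo)%E.
Proof.
have mX k : measurable_fun [set: R] (fun x : R => x ^+ k) by exact: measurable_funX.
rewrite (@ge0_integral_density _ _ _ mu _ (normal_pdf 0 1)).
- (* x ^ 2n exp(- x^2 / 2) <= n! 4^n exp(- x^2 / 4), a multiple of the density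
     of variance 2 *)
  pose C := n`!%:R * 4 ^+ n * normal_peak 1 / normal_peak (Num.sqrt 2) : R.
  apply: (@le_lt_trans _ _ (\int[mu]_x (C%:E * (normal_pdf 0 (Num.sqrt 2) x)%:E))%E).
    apply: ge0_le_integral => //.
    + by move=> x _; rewrite -EFinM lee_fin mulr_ge0 ?normal_pdf_ge0.
    + apply/measurable_EFinP; apply: measurable_funM => //.
      exact: measurable_normal_pdf.
    + apply/measurable_EFinP; apply: measurable_funM => //.
      exact: measurable_normal_pdf.
    + move=> x _; rewrite -!EFinM lee_fin.
      have s2 : Num.sqrt 2 != 0 :> R by rewrite gt_eqF// sqrtr_gt0.
      rewrite /normal_pdf (negbTE s2) oner_eq0 /normal_fun !subr0.
      rewrite sqr_sqrtr// expr1n.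
      have pk0 : normal_peak (Num.sqrt 2) != 0 :> R by rewrite gt_eqF// normal_peak_gt0.
      rewrite /C [leRHS]mulrA divfK// mulrCA -[leRHS]mulrA [leRHS]mulrCA.
      apply: ler_wpM2l; first exact: normal_peak_ge0.
      have -> : - x ^+ 2 / (1 *+ 2) = - (x ^+ 2 / 4) + (- x ^+ 2 / (2 *+ 2)) :> R by field.
      rewrite expRD mulrA; apply: ler_wpM2r; first exact: expR_ge0.
      rewrite expRN ler_pdivrMr ?expR_gt0//.
      have -> : x ^+ n.*2 = 4 ^+ n * (x ^+ 2 / 4) ^+ n.
        by rewrite -mul2n exprM -exprMn; congr (_ ^+ _); field.
      rewrite [n`!%:R * _]mulrC -[leRHS]mulrA ler_wpM2l ?exprn_ge0//.
      case: (n) => [|k]; first by rewrite expr0 mul1r -[leLHS]expR0 ler_expR divr_ge0 ?sqr_ge0.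
      rewrite -ler_pdivrMl ?ltr0n ?fact_gt0// mulrC.
      apply: le_trans (expR_ge1Dxn k _); last by rewrite divr_ge0 ?sqr_ge0.
      by rewrite lerDr.
  rewrite integralZl//; last exact: integrable_normal_pdf.
  by rewrite integral_normal_pdf mule1 ltry.
- exact: normal_pdf_ge0.
- exact: measurable_normal_pdf.
- by [].
- exact/measurable_EFinP.
- by move=> x; rewrite lee_fin.
Qed.

Lemma gauss_moment_gt0 n : 0 < gauss_moment n.
Proof.
have mX k : measurable_fun [set: R] (fun x : R => x ^+ k) by exact: measurable_funX.
rewrite lt_neqAle fine_ge0 ?andbT; last first.
  by apply: integral_ge0 => x _; rewrite lee_fin.
apply/eqP => m0.
have I0 : (\int[normal_prob 0 1]_x ((x ^+ n.*2)%:E : \bar R) = 0)%E.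
  rewrite -[LHS]fineK ?ge0_fin_numE ?gauss_moment_fin//; last first.
    by apply: integral_ge0 => x _; rewrite lee_fin.
  by rewrite -/(gauss_moment n) -m0.
have [N [mN N0 hN]] : {ae normal_prob 0 1, forall x : measurableTypeR R, x ^+ n.*2 = 0}.
  have := @ae_eq_integral_abs _ _ R (normal_prob 0 1) setT measurableT
    (fun x => (x ^+ n.*2)%:E).
  have mE : measurable_fun [set: measurableTypeR R] (fun x : R => (x ^+ n.*2)%:E).
    exact/measurable_EFinP.
  move=> /(_ mE) [+ _].
  have -> : (\int[normal_prob 0 1]_x `|(x ^+ n.*2)%:E| = 0 :> \bar R)%E.
    by rewrite -[RHS]I0; apply: eq_integral => x _; rewrite gee0_abs ?lee_fin.
  by move=> /(_ erefl); apply: filterS => x /(_ I) /= [].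
have : normal_prob 0 1 [set: R] = 0%E :> \bar R.
  have h0 : normal_prob 0 1 [set 0 : R] = 0%E :> \bar R.
    by rewrite /normal_prob integral_set1.
  apply/eqP; rewrite -measure_le0.
  apply: (@le_trans _ _ (normal_prob 0 1 (N `|` [set 0 : R]))).
    apply: le_measure; rewrite ?inE//; first exact: measurableU.
    move=> x _; have [->|x0] := eqVneq x 0; [by right|left].
    by apply: hN => /= /eqP; rewrite expf_eq0 (negbTE x0) andbF.
  apply: (le_trans (measureU2 _ _ _)) => //.
  by rewrite -[leRHS]adde0; apply: leeD; rewrite le_eqVlt; apply/orP; left; apply/eqP;
    [exact: N0|exact: h0].
by rewrite probability_setT => /eqP; rewrite onee_eq0.
Qed.

End GaussianMoments.

Section CenteredNormalMoments.
Context {R : realType} {d : measure_display} {Omega : measurableType d}.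
Variable P : probability Omega R.

(** Scaling reduces this to the standard normal law; the degenerate law, with
    [s = 0], has the same formula because [0 < n]. *)
Lemma centered_normal_moment (Y : Omega -> R) (s : R) n : (0 < n)%N ->
  measurable_fun setT Y -> centered_normal P Y s ->
  'E_P[(fun w => Y w ^+ n.*2)%R]%E = (s ^+ n.*2 * gauss_moment n)%:E.
Proof.
move=> n0 mYR hY.
have even_ge0 (x : R) : 0 <= x ^+ n.*2 by rewrite -mul2n exprM exprn_ge0// sqr_ge0.
have mX : measurable_fun [set: R] (fun x : R => (x ^+ n.*2)%:E).
  by apply/measurable_EFinP; exact: measurable_funX.
have mY : measurable_fun [set: Omega] (Y : Omega -> measurableTypeR R).
  exact: mYR.
rewrite unlock.
have <- : (\int[pushforward P (Y : Omega -> measurableTypeR R)]_x (x ^+ n.*2)%:E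
    = \int[P]_w (Y w ^+ n.*2)%:E)%E.
  by rewrite (ge0_integral_pushforward mY _ measurableT mX)// => x _; rewrite lee_fin.
have [s0|s0] := eqVneq s 0.
  transitivity (\int[\d_((0 : R)%R : measurableTypeR R)]_x ((x ^+ n.*2)%:E : \bar R))%E.
    apply: eq_measure_integral => A mA _.
    by have := hY A mA; rewrite s0 eqxx.
  rewrite integral_dirac// diracT mul1e s0.
  by rewrite !expr0n double_eq0 gtn_eqF// mul0r.
have sgt0 : 0 < `|s| by rewrite normr_gt0.
have ms : measurable_fun [set: measurableTypeR R] (fun x : R => `|s| * x : measurableTypeR R).
  exact: mulrl_measurable.
transitivity (\int[normal_prob 0 1]_x (((`|s| * x)%R ^+ n.*2)%:E : \bar R))%E.
  have <- : (\int[pushforward (normal_prob 0 1) (fun x : R => (`|s| * x)%R : measurableTypeR R)]_x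
      ((x ^+ n.*2)%:E : \bar R)
      = \int[normal_prob 0 1]_x (((`|s| * x)%R ^+ n.*2)%:E : \bar R))%E.
    by rewrite (ge0_integral_pushforward ms _ measurableT mX)// => x _; rewrite lee_fin.
  apply: eq_measure_integral => A mA _.
  by have := hY A mA; rewrite (negbTE s0) normal_prob_scale.
under eq_integral do rewrite exprMn EFinM.
rewrite ge0_integralZl//; last by move=> x _; rewrite lee_fin.
rewrite EFinM; congr (_ * _)%E.
  by rewrite -mul2n !exprM real_normK// num_real.
rewrite fineK// ge0_fin_numE ?gauss_moment_fin//.
by apply: integral_ge0 => x _; rewrite lee_fin.
Qed.

End CenteredNormalMoments.

Section MixedMomentCoefficients.
Context {R : realType}.

Definition central_coef (n : nat) : R := ((1 + 'X ^+ 2) ^+ n : {poly R})`_n.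

Let central_coefE n :
  central_coef n = \sum_(j < n.+1) (n == j.*2)%:R *+ 'C(n, j).
Proof.
rewrite /central_coef exprDn coef_sum; apply: eq_bigr => j _.
by rewrite expr1n mul1r -exprM mul2n coefMn coefXn.
Qed.

Lemma central_coef_ge0 n : 0 <= central_coef n.
Proof.
by rewrite central_coefE; apply: sumr_ge0 => j _; rewrite mulrn_wge0.
Qed.

Lemma central_coef_odd n : odd n -> central_coef n = 0.
Proof.
move=> on; rewrite central_coefE big1// => j _.
case: eqP => [nE|_]; last by rewrite mul0rn.
by rewrite nE odd_double in on.
Qed.

Lemma central_coef0 : central_coef 0 = 1.
Proof. by rewrite /central_coef expr0 coef1. Qed.

(** For a centered Gaussian pair [(U, V)] with variances [v] and covariance
    [t], [E (U ^ m * V ^ m)] is the sum of the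
    [mixed_coef m i * v ^ (m - i) * t ^ i].  They come out as the coefficients
    of [b ^ m] in [E (U + b * V) ^ (2 * m)], which is proportional to
    [(v + 2 * b * t + b ^ 2 * v) ^ m].  *)
Definition mixed_coef (m i : nat) : R :=
  gauss_moment m / gauss_moment 1 ^+ m / 'C(m.*2, m)%:R
  * 'C(m, i)%:R * 2 ^+ i * central_coef (m - i).

Let lead_gt0 m : 0 < gauss_moment m / gauss_moment 1 ^+ m / 'C(m.*2, m)%:R :> R.
Proof.
rewrite !divr_gt0 ?exprn_gt0 ?gauss_moment_gt0// ltr0n bin_gt0.
by rewrite -addnn leq_addr.
Qed.

Lemma mixed_coef_ge0 m i : 0 <= mixed_coef m i.
Proof.
by rewrite mulr_ge0 ?central_coef_ge0// mulr_ge0 ?exprn_ge0// mulr_ge0// ltW.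
Qed.

Lemma mixed_coef_gt0 m : 0 < mixed_coef m m.
Proof.
by rewrite /mixed_coef subnn central_coef0 mulr1 binn mulr1 mulr_gt0// exprn_gt0.
Qed.

Lemma mixed_coef_even m i : odd m -> (i <= m)%N -> ~~ odd i -> mixed_coef m i = 0.
Proof.
move=> om im oi; have omi : odd (m - i) by rewrite oddB// om (negbTE oi).
by rewrite /mixed_coef central_coef_odd// mulr0.
Qed.

Lemma coef_variance_pow (v t : R) m :
  ((v *: (1 + 'X ^+ 2) + (2 * t) *: 'X) ^+ m : {poly R})`_m
  = \sum_(i < m.+1) 'C(m, i)%:R * 2 ^+ i * central_coef (m - i)
      * v ^+ (m - i) * t ^+ i.
Proof.
rewrite exprDn coef_sum; apply: eq_bigr => -[i /= im] _.
rewrite (exprZn v) (exprZn (2 * t)) -scalerAr -scalerAl scalerA coefMn coefZ coefMXn.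
rewrite ltnNge -ltnS im/= exprMn -mulr_natl /central_coef; ring.
Qed.

Lemma polyfun_inj (p q : {poly R}) : (forall x, p.[x] = q.[x]) -> p = q.
Proof.
move=> pq; apply/eqP; rewrite -subr_eq0; apply/negPn/negP => pq0.
pose rs : seq R := [seq n%:R | n <- iota 0 (size (p - q)).+1].
have h1 : all (root (p - q)) rs.
  by apply/allP => x _; rewrite /root !hornerE pq subrr.
have h2 : uniq rs.
  by rewrite map_inj_uniq ?iota_uniq// => i j /eqP; rewrite eqr_nat => /eqP.
by have := max_poly_roots pq0 h1 h2; rewrite size_map size_iota ltnNge leqnSn.
Qed.

End MixedMomentCoefficients.

Section GaussianPair.
Context {R : realType} {d : measure_display} {Omega : measurableType d}.
Variable P : probability Omega R.
Local Notation Ex f := (\int[P]_w (f w)).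

Variables (U V : Omega -> R).
Hypothesis mU : measurable_fun setT U.
Hypothesis mV : measurable_fun setT V.
Hypothesis UV_normal : forall a b : R,
  exists s, centered_normal P (fun w => a * U w + b * V w) s.

Let mUV a b : measurable_fun setT (fun w => a * U w + b * V w).
Proof. by apply: measurable_funD; exact: measurable_funM. Qed.

Let even_ge0 n (x : R) : 0 <= x ^+ n.*2.
Proof. by rewrite -mul2n exprM exprn_ge0// sqr_ge0. Qed.

Let pow_integrable a b n : P.-integrable setT (fun w => ((a * U w + b * V w) ^+ n.*2)%:E).
Proof.
case: n => [|n].
  have := finite_measure_integrable_cst P (1 : R) (@measurableT _ Omega).
  by apply: eq_integrable => // w _; rewrite /= expr0.
have [s hs] := UV_normal a b.
apply/integrableP; split.
  by apply/measurable_EFinP; exact: measurable_funX.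
under eq_integral do rewrite gee0_abs ?lee_fin//.
have := centered_normal_moment (ltn0Sn n) (mUV a b) hs.
by rewrite unlock => ->; rewrite ltry.
Qed.

Lemma mixed_integrable i j n : (i + j = n.*2)%N ->
  P.-integrable setT (fun w => (U w ^+ i * V w ^+ j)%:E).
Proof.
move=> ijn.
have iU : P.-integrable setT (fun w => (U w ^+ n.*2)%:E).
  have := pow_integrable 1 0 n; apply: eq_integrable => // w _.
  by rewrite mul1r mul0r addr0.
have iV : P.-integrable setT (fun w => (V w ^+ n.*2)%:E).
  have := pow_integrable 0 1 n; apply: eq_integrable => // w _.
  by rewrite mul1r mul0r add0r.
apply: le_integrable (integrableD measurableT iU iV) => //.
  by apply/measurable_EFinP; apply: measurable_funM; exact: measurable_funX.
move=> w _ /=; rewrite lee_fin [leRHS]ger0_norm ?addr_ge0//.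
have aE (x : R) : x ^+ n.*2 = `|x| ^+ n.*2.
  by rewrite -mul2n !exprM real_normK// num_real.
rewrite normrM !normrX (aE (U w)) (aE (V w)) -ijn !exprD.
have [h|h] := leP `|U w| `|V w|.
  rewrite (@le_trans _ _ (`|V w| ^+ i * `|V w| ^+ j))//.
    by rewrite ler_wpM2r ?exprn_ge0// lerXn2r ?nnegrE.
  by rewrite lerDr mulr_ge0 ?exprn_ge0.
rewrite (@le_trans _ _ (`|U w| ^+ i * `|U w| ^+ j))//.
  by rewrite ler_wpM2l ?exprn_ge0// lerXn2r ?nnegrE// ltW.
by rewrite lerDl mulr_ge0 ?exprn_ge0.
Qed.

Let ExUV n b : Ex (fun w => (U w + b * V w) ^+ n.*2)
  = \sum_(j < n.*2.+1) ('C(n.*2, j)%:R * Ex (fun w => U w ^+ (n.*2 - j) * V w ^+ j)) * b ^+ j.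
Proof.
pose F j w := U w ^+ (n.*2 - j) * V w ^+ j.
have iF (j : 'I_n.*2.+1) : P.-integrable setT (fun w => (F j w)%:E).
  by apply: (@mixed_integrable _ _ n); rewrite subnK// -ltnS.
transitivity (Ex (fun w => \sum_(j < n.*2.+1) ('C(n.*2, j)%:R * b ^+ j) * F j w)).
  apply: eq_Rintegral => w _; rewrite exprDn; apply: eq_bigr => j _.
  by rewrite exprMn -mulr_natl /F; ring.
rewrite /Rintegral.
under eq_integral do rewrite -sumEFin.
rewrite integral_sum//; last first.
  move=> j; under eq_fun do rewrite EFinM.
  exact: (integrableZl measurableT).
under eq_bigr => j _.
  under eq_integral do rewrite EFinM.
  rewrite integralZl// -(fineK (integrable_fin_num _ (iF j)))// -EFinM.
  over.
rewrite sumEFin/=; apply: eq_bigr => j _.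
by rewrite -/(Rintegral _ _ _) mulrAC.
Qed.

(** Both sides of [E (U + b V) ^ (2 m) = c * (E (U + b V) ^ 2) ^ m] are
    polynomials in [b], so their coefficients agree. *)
Lemma mixed_moment m (v t : R) : (0 < m)%N ->
  Ex (fun w => U w ^+ 2) = v -> Ex (fun w => V w ^+ 2) = v ->
  Ex (fun w => U w * V w) = t ->
  Ex (fun w => U w ^+ m * V w ^+ m)
  = \sum_(i < m.+1) mixed_coef m i * v ^+ (m - i) * t ^+ i.
Proof.
move=> m0 hU hV hUV.
pose K : R := gauss_moment m / gauss_moment 1 ^+ m.
pose p := \poly_(j < m.*2.+1)
  ('C(m.*2, j)%:R * Ex (fun w => U w ^+ (m.*2 - j) * V w ^+ j)).
pose q := K *: (v *: (1 + 'X ^+ 2) + (2 * t) *: 'X) ^+ m.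
have var2 b : Ex (fun w => (U w + b * V w) ^+ 2) = v + 2 * b * t + b ^+ 2 * v.
  have E0 : Ex (fun w => U w ^+ (1.*2 - 0) * V w ^+ 0) = v.
    by rewrite -hU; apply: eq_Rintegral => w _; rewrite expr0 mulr1.
  have E1 : Ex (fun w => U w ^+ (1.*2 - 1) * V w ^+ 1) = t.
    by rewrite -hUV; apply: eq_Rintegral => w _; rewrite !expr1.
  have E2 : Ex (fun w => U w ^+ (1.*2 - 2) * V w ^+ 2) = v.
    by rewrite -hV; apply: eq_Rintegral => w _; rewrite expr0 mul1r.
  rewrite (ExUV 1 b) !big_ord_recr big_ord0 E0 E1 E2 /= !bin0 binn bin1.
  by rewrite -!mul2n; ring.
have pq : p = q.
  apply: polyfun_inj => b.
  rewrite /p horner_poly -ExUV /q !hornerE.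
  have [s hs] := UV_normal 1 b.
  have momE n : (0 < n)%N ->
      Ex (fun w => (U w + b * V w) ^+ n.*2) = s ^+ n.*2 * gauss_moment n.
    move=> n0; have h := centered_normal_moment n0 (mUV 1 b) hs.
    rewrite /Rintegral (_ : (\int[P]_w _)%E = (s ^+ n.*2 * gauss_moment n)%:E)//.
    by rewrite -h unlock; apply: eq_integral => w _; rewrite mul1r.
  have := momE 1%N isT; rewrite var2 => s2.
  rewrite momE// -mul2n exprM.
  have g1 := gauss_moment_gt0 (R := R) 1.
  have -> : s ^+ 2 = (v + 2 * b * t + b ^+ 2 * v) / gauss_moment 1.
    by rewrite s2 mulfK// gt_eqF.
  transitivity (K * (v + 2 * b * t + b ^+ 2 * v) ^+ m).
    by rewrite expr_div_n /K; ring.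
  by congr (_ * _ ^+ _); ring.
have := congr1 (fun r : {poly R} => r`_m) pq.
rewrite /p coef_poly ltnS -addnn leq_addr addnK /q coefZ coef_variance_pow.
rewrite addnn => h.
have C0 : 'C(m.*2, m)%:R != 0 :> R.
  by rewrite pnatr_eq0 -lt0n bin_gt0 -addnn leq_addr.
apply: (mulfI C0); rewrite h !mulr_sumr; apply: eq_bigr => i _.
rewrite /mixed_coef -/K; field.
by rewrite ?C0.
Qed.

End GaussianPair.

(** * The second moment of an integrated process *)

Section SecondMomentOfIntegral.
Local Open Scope ereal_scope.
Context d1 d2 (T1 : measurableType d1) (T2 : measurableType d2) (R : realType).
Variables (mu : {sigma_finite_measure set T1 -> \bar R}) (P : probability T2 R).
Variables (D : set T1) (k : T1 * T2 -> R) (M : R).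
Hypothesis mD : measurable D.
Hypothesis muD : mu D < +oo.
Hypothesis mk : measurable_fun setT k.
Hypothesis k_supp : forall s w, ~ D s -> k (s, w) = 0%R.
Hypothesis k_sqr : forall s, \int[P]_w ((k (s, w)) ^+ 2)%:E <= M%:E.

Let u s : R := \1_D s.

(* the positivity and measurability side conditions of the integral lemmas *)
Local Ltac side := first
  [ done | by rewrite lee_fin | by rewrite lee_fin sqr_ge0
  | by move=> *; rewrite lee_fin | by move=> *; rewrite lee_fin sqr_ge0
  | by move=> *; rewrite mule_ge0 ?lee_fin ?sqr_ge0
  | exact/measurable_EFinP
  | by apply/measurable_EFinP; exact: measurable_funM
  | by apply/measurable_EFinP; exact: measurable_funX
  | by apply: emeasurable_funM; side
  | by apply: emeasurable_funD; side ].

Let u_ge0 s : (0 <= u s)%R. Proof. by []. Qed.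

Let mu_u : measurable_fun setT u. Proof. exact: measurable_indic. Qed.

Let ku s w : (k (s, w) * u s = k (s, w))%R.
Proof.
rewrite /u indicE; case: (boolP (s \in D)) => [|/negP sD]; first by rewrite mulr1.
by rewrite k_supp ?mul0r// => /mem_set.
Qed.

Let int_u (c : R) : (0 <= c)%R -> \int[mu]_s (c * u s)%:E = c%:E * mu D.
Proof.
move=> c0; under eq_integral do rewrite EFinM.
rewrite ge0_integralZl; try side.
by rewrite integral_indic// setIT.
Qed.

Let M_ge0 : D !=set0 -> (0 <= M)%R.
Proof.
move=> [s _]; rewrite -lee_fin; apply: le_trans (k_sqr s).
by apply: integral_ge0 => w _; rewrite lee_fin sqr_ge0.
Qed.

Let mks s : measurable_fun setT (fun w => k (s, w)).
Proof. exact: measurable_fun_pair2. Qed.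

Let mkw w : measurable_fun setT (fun s => k (s, w)).
Proof. exact: measurable_fun_pair1. Qed.

Let mk2 : measurable_fun setT (fun p => (k p ^+ 2)%:E).
Proof. by apply/measurable_EFinP; exact: measurable_funX. Qed.

Let mka : measurable_fun setT (fun p => `|k p|%:E).
Proof. by apply/measurable_EFinP; exact: measurableT_comp. Qed.

Let mka1 w : measurable_fun setT (fun s => `|k (s, w)|%:E).
Proof. exact: (measurable_fun_pair1 (f := fun p => `|k p|%:E)). Qed.

Let mk21 w : measurable_fun setT (fun s => (k (s, w) ^+ 2)%:E).
Proof. exact: (measurable_fun_pair1 (f := fun p => (k p ^+ 2)%:E)). Qed.

Let mk22 s : measurable_fun setT (fun w => (k (s, w) ^+ 2)%:E).
Proof. exact: (measurable_fun_pair2 (f := fun p => (k p ^+ 2)%:E)). Qed.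

(* the L^1 and squared L^2 norms of the path of w *)
Let A w := \int[mu]_s `|k (s, w)|%:E.
Let B w := \int[mu]_s (k (s, w) ^+ 2)%:E.

Let A_ge0 w : 0 <= A w.
Proof. by apply: integral_ge0 => s _; rewrite lee_fin. Qed.

Let B_ge0 w : 0 <= B w.
Proof. by apply: integral_ge0 => s _; rewrite lee_fin sqr_ge0. Qed.

Let mA : measurable_fun setT A.
Proof. exact: (measurable_fun_fubini_tonelli_G (fun p => `|k p|%:E)). Qed.

Let mB : measurable_fun setT B.
Proof.
apply: (measurable_fun_fubini_tonelli_G (fun p => (k p ^+ 2)%:E)) => //.
by move=> p; rewrite lee_fin sqr_ge0.
Qed.

Let intB : \int[P]_w B w < +oo.
Proof.
rewrite -(fubini_tonelli (fun p => (k p ^+ 2)%:E))//; last first.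
  by move=> p; rewrite lee_fin sqr_ge0.
have [D0|/set0P/M_ge0 M0] := eqVneq D set0.
  rewrite integral0_eq// => s _; apply: integral0_eq => w _.
  by rewrite k_supp ?expr0n// D0.
apply: (@le_lt_trans _ _ (\int[mu]_s (M * u s)%:E)).
  apply: ge0_le_integral => //.
  - by move=> s _; apply: integral_ge0 => w _; rewrite lee_fin sqr_ge0.
  - apply: (measurable_fun_fubini_tonelli_F (fun p => (k p ^+ 2)%:E)) => //.
    by move=> p; rewrite lee_fin sqr_ge0.
  - by apply/measurable_EFinP; exact: measurable_funM.
  - move=> s _; rewrite /u indicE; case: (boolP (s \in D)) => [_|/negP sD].
      by rewrite mulr1; exact: k_sqr.
    rewrite mulr0 integral0_eq// => w _.
    by rewrite k_supp ?expr0n// => /mem_set.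
by rewrite int_u// lte_mul_pinfty.
Qed.

Let AB w : A w <= mu D + B w.
Proof.
apply: (@le_trans _ _ (\int[mu]_s ((u s)%:E + (k (s, w) ^+ 2)%:E))).
  apply: ge0_le_integral; try side.
  move=> s _; rewrite -EFinD lee_fin -ku normrM (ger0_norm (u_ge0 s)).
  have : u s = 0%R \/ u s = 1%R by rewrite /u indicE; case: (_ \in _); [right|left].
  case=> ->; first by rewrite !mulr0 add0r sqr_ge0.
  rewrite !mulr1 -real_normK ?num_real//.
  have := normr_ge0 (k (s, w)); set x := `|_|%R; nra.
rewrite ge0_integralD; try side.
by rewrite integral_indic// setIT.
Qed.

(* from [|x * y| <= x ^ 2 + y ^ 2] *)
Let kA s w : `|k (s, w)|%:E * A w <= (k (s, w) ^+ 2)%:E * mu D + (u s)%:E * B w.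
Proof.
rewrite /A -ge0_integralZl; try side.
apply: (@le_trans _ _ (\int[mu]_t ((k (s, w) ^+ 2)%:E * (u t)%:E
    + (u s)%:E * (k (t, w) ^+ 2)%:E))).
  apply: ge0_le_integral; try side.
  move=> t _; rewrite -!EFinM -EFinD lee_fin -normrM -(ku s) -(ku t).
  have h r : u r = 0%R \/ u r = 1%R by rewrite /u indicE; case: (_ \in _); [right|left].
  have := h s; have := h t; move=> [] -> [] ->;
    rewrite ?mulr0 ?mul0r ?mulr1 ?mul1r ?normr0 ?addr_ge0 ?mulr_ge0 ?sqr_ge0//.
  rewrite normrM -(real_normK (num_real (k (s, w)))) -(real_normK (num_real (k (t, w)))).
  have := sqr_ge0 (`|k (s, w)| - `|k (t, w)|)%R.
  have := normr_ge0 (k (s, w)); have := normr_ge0 (k (t, w)).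
  by set x := `|_|%R; set y := `|_|%R => ? ?; nra.
rewrite ge0_integralD; try side.
rewrite ge0_integralZl; try side.
by rewrite integral_indic// setIT leeD2l// ge0_integralZl; try side.
Qed.

Let AA w : A w * A w <= mu D * B w + mu D * B w.
Proof.
rewrite {1}/A -ge0_integralZr; try side.
apply: (@le_trans _ _ (\int[mu]_s ((k (s, w) ^+ 2)%:E * mu D + (u s)%:E * B w))).
  by apply: ge0_le_integral; try side.
rewrite ge0_integralD; try side.
rewrite ge0_integralZr; try side.
rewrite ge0_integralZr; try side.
by rewrite integral_indic// setIT muleC.
Qed.

Let muD_fin : mu D \is a fin_num.
Proof. by rewrite ge0_fin_numE. Qed.

Let intA : \int[P]_w A w < +oo.
Proof.
apply: (@le_lt_trans _ _ (\int[P]_w (mu D + B w))).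
  by apply: ge0_le_integral; try side.
rewrite ge0_integralD; try side.
rewrite integral_cst// lte_add_pinfty// lte_mul_pinfty//.
by rewrite (le_lt_trans (probability_le1 P measurableT)) ?ltry.
Qed.

Let intAA : \int[P]_w (A w * A w) < +oo.
Proof.
apply: (@le_lt_trans _ _ (\int[P]_w (mu D * B w + mu D * B w))).
  by apply: ge0_le_integral; try side.
rewrite ge0_integralD; try side.
by rewrite ge0_integralZl; try side; rewrite lte_add_pinfty// lte_mul_pinfty.
Qed.

Let int_k : (mu \x P).-integrable setT (fun p => (k p)%:E).
Proof.
apply/integrable21ltyP; first exact/measurable_EFinP.
exact: intA.
Qed.

Let H w : R := fine (\int[mu]_s (k (s, w))%:E).

Lemma measurable_path_integral :
  measurable_fun setT (fun w => fine (\int[mu]_s (k (s, w))%:E)).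
Proof.
by apply: measurableT_comp => //; exact: (measurable_fubini_G int_k).
Qed.

Let mH : measurable_fun setT H := measurable_path_integral.

Let H_le w : `|H w|%:E <= A w.
Proof.
have [Afin|] := boolP (A w < +oo); last first.
  by rewrite -leNgt leye_eq => /eqP ->; rewrite leey.
rewrite /H -/(Rintegral mu setT (fun s => k (s, w))) EFin_normr_Rintegral//.
  by apply: le_abse_integral => //; exact/measurable_EFinP.
by apply/integrableP; split; [exact/measurable_EFinP|].
Qed.

Let int_ks s : (mu \x P).-integrable setT (fun p => (k (s, p.2) * k p)%:E).
Proof.
have mks2 : measurable_fun setT (fun p : T1 * T2 => (k (s, p.2) * k p)%R).
  apply: measurable_funM => //.
  by apply: (measurableT_comp (mks s)); exact: measurable_snd.
apply/integrable21ltyP; first exact/measurable_EFinP.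
apply: (@le_lt_trans _ _ (\int[P]_w ((k (s, w) ^+ 2)%:E * mu D + (u s)%:E * B w))).
  apply: ge0_le_integral => //.
  - by move=> w _; apply: integral_ge0.
  - apply: (measurable_fun_fubini_tonelli_G (fun p => `|(k (s, p.2) * k p)%:E|)) => //.
    by apply: measurableT_comp => //; exact/measurable_EFinP.
  - by side.
  - move=> w _; apply: le_trans (kA s w).
    rewrite /A -ge0_integralZl; try side.
    rewrite le_eqVlt; apply/orP; left; apply/eqP; apply: eq_integral => t _ /=.
    by rewrite normrM EFinM.
rewrite ge0_integralD; try side.
rewrite ge0_integralZr; try side.
rewrite ge0_integralZl; try side.
rewrite lte_add_pinfty//; last by rewrite lte_mul_pinfty ?lee_fin.
by rewrite muleC lte_mul_pinfty// (le_lt_trans (k_sqr s))// ltry.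
Qed.

Let int_kH : (mu \x P).-integrable setT (fun p => (k p * H p.2)%:E).
Proof.
have mkH : measurable_fun setT (fun p : T1 * T2 => (k p * H p.2)%R).
  apply: measurable_funM => //.
  by apply: (measurableT_comp mH); exact: measurable_snd.
apply/integrable21ltyP; first exact/measurable_EFinP.
apply: le_lt_trans intAA; apply: ge0_le_integral => //.
- by move=> w _; apply: integral_ge0.
- apply: (measurable_fun_fubini_tonelli_G (fun p => `|(k p * H p.2)%:E|)) => //.
  by apply: measurableT_comp => //; exact/measurable_EFinP.
- exact: emeasurable_funM.
- move=> w _ /=; under eq_integral do rewrite normrM EFinM.
  rewrite ge0_integralZr; try side.
  by apply: lee_wpmul2l; [exact: A_ge0|exact: H_le].
Qed.

(* For the exceptional [w] the real-valued integral [H w] has no meaning. *)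
Let ae_int : {ae P, forall w, mu.-integrable setT (fun s => (k (s, w))%:E)}.
Proof. exact: (ae_integrable2 int_k). Qed.

(** Fubini's theorem is applied to one factor at a time, which avoids a triple
    product space. *)
Lemma second_moment_integral :
  \int[P]_w ((fine (\int[mu]_s (k (s, w))%:E)) ^+ 2)%:E
  = \int[mu]_s \int[mu]_t \int[P]_w (k (s, w) * k (t, w))%:E.
Proof.
transitivity (\int[P]_w \int[mu]_s (k (s, w) * H w)%:E).
  apply: ae_eq_integral => //.
  - by apply/measurable_EFinP; exact: measurable_funX.
  - exact: (measurable_fubini_G int_kH).
  - apply: filterS ae_int => w iw _.
    under [RHS]eq_integral do rewrite EFinM.
    rewrite integralZr// expr2 EFinM; congr (_ * _).
    by rewrite fineK//; exact: integrable_fin_num.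
rewrite -(Fubini int_kH); apply: eq_integral => s _.
transitivity (\int[P]_w \int[mu]_t (k (s, w) * k (t, w))%:E).
  apply: ae_eq_integral => //.
  - by apply/measurable_EFinP; exact: measurable_funM.
  - exact: (measurable_fubini_G (int_ks s)).
  - apply: filterS ae_int => w iw _.
    under [RHS]eq_integral do rewrite EFinM.
    rewrite integralZl// EFinM; congr (_ * _).
    by rewrite fineK//; exact: integrable_fin_num.
by rewrite -(Fubini (int_ks s)).
Qed.

End SecondMomentOfIntegral.

(** * Integration over the square *)

Section Clamp.
Context {R : realType}.
Implicit Types (S x y : R).

Definition clamp S x : R := Num.max 0 (Num.min x S).

Lemma clamp_homo S : {homo clamp S : x y / x <= y}.
Proof. by move=> x y xy; apply: le_max2 => //; exact: le_min2. Qed.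

Lemma clamp_id S x : 0 <= x -> x <= S -> clamp S x = x.
Proof. by move=> x0 xS; rewrite /clamp min_l// max_r. Qed.

Lemma clamp_ge0 S x : 0 <= clamp S x.
Proof. by rewrite /clamp le_max lexx. Qed.

Lemma clamp_le S x : 0 <= S -> clamp S x <= S.
Proof. by move=> S0; rewrite /clamp ge_max S0 ge_min lexx orbT. Qed.

Lemma homo_clamp_bm S (f : R -> R) : 0 <= S ->
  (forall x y, 0 <= x -> x <= y -> y <= S -> f x <= f y) ->
  {homo (fun x => f (clamp S x)) : x y / x <= y} /\
  bounded_measurable (fun x => f (clamp S x)).
Proof.
move=> S0 hf.
have h : {homo (fun x => f (clamp S x)) : x y / x <= y}.
  by move=> x y xy; apply: hf; [exact: clamp_ge0|exact: clamp_homo|exact: clamp_le].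
split => //; split; first exact: nondecreasing_measurable.
exists (`|f 0| + `|f S|) => x.
have h1 : f 0 <= f (clamp S x) by apply: hf; [|exact: clamp_ge0|exact: clamp_le].
have h2 : f (clamp S x) <= f S by apply: hf; [exact: clamp_ge0|exact: clamp_le|].
rewrite ler_norml; apply/andP; split.
- have := ler_norm (- f 0); rewrite normrN; have := normr_ge0 (f S); lra.
- have := ler_norm (f S); have := normr_ge0 (f 0); lra.
Qed.

(** A primitive of a bounded function is a difference of monotone functions. *)
Lemma bm_primitive S (F : R -> R) : 0 <= S -> bounded_measurable F ->
  bounded_measurable (fun v => integ 0 (clamp S v) F).
Proof.
move=> S0 bF; have [_ [M hM]] := bF.
have bFM : bounded_measurable (fun x => F x + M) by apply: bmD => //; exact: bm_cst.
have [_ b1] := @homo_clamp_bm S (fun v => integ 0 v (fun x => F x + M)) S0 ltac:(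
  move=> x y x0 xy yS /=; rewrite (integ_split (c := x) (b := y))// lerDl;
  apply: integ_ge0 => z _ _; have := hM z; rewrite ler_norml => /andP[]; lra).
have [_ b2] := @homo_clamp_bm S id S0 (fun x y _ xy _ => xy).
have := bmB b1 (bmM (bm_cst M) b2); congr bounded_measurable.
apply/funext => v; rewrite integD//; last exact: bm_cst.
by rewrite integ_cst ?clamp_ge0// subr0 mulrC addrK.
Qed.

(** [x + h] and [y] are convex combinations of [x] and [y + h] with exchanged
    weights. *)
Lemma concave_on_increments S (f : R -> R) : concave_on `[0, S] f ->
  forall x y h, 0 <= x -> x <= y -> 0 <= h -> y + h <= S ->
  f (y + h) - f y <= f (x + h) - f x.
Proof.
move=> cf x y h x0 xy h0 yS.
have [L0|Lpos] := leP (y + h - x) 0.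
  have -> : h = 0 by lra.
  by rewrite !addr0 !subrr.
have comb l : 0 <= l -> l <= 1 ->
    l * f x + (1 - l) * f (y + h) <= f (l * x + (1 - l) * (y + h)).
  move=> l0 l1; have := cf (Itv01 l0 l1) x (y + h).
  rewrite !inE/= !in_itv/= => /(_ _ _); rewrite !convRE/= /unstable.onem.
  have -> : (0 <= x <= S) by apply/andP; split; lra.
  have -> : (0 <= y + h <= S) by apply/andP; split; lra.
  move=> /(_ isT isT); lra.
pose l := h / (y + h - x).
have l0 : 0 <= l by rewrite divr_ge0// ltW.
have l1 : l <= 1 by rewrite ler_pdivrMr// mul1r; lra.
have e1 : l * x + (1 - l) * (y + h) = y.
  by rewrite /l; field; rewrite gt_eqF.
have e2 : (1 - l) * x + (1 - (1 - l)) * (y + h) = x + h.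
  by rewrite /l; field; rewrite gt_eqF.
have := comb l l0 l1; have := comb (1 - l) ltac:(lra) ltac:(lra).
rewrite e1 e2; lra.
Qed.

End Clamp.

Section DoubleIntegral.
Context {R : realType}.
Variables (T : R) (F : R -> R).
Hypothesis T_gt0 : 0 < T.
Hypothesis bF : bounded_measurable F.

Lemma integ_dist s : 0 <= s -> s <= T ->
  integ 0 T (fun t => F `|t - s|) = integ 0 s F + integ 0 (T - s) F.
Proof.
move=> s0 sT.
have mabs : measurable_fun [set: R] (fun t : R => `|t - s|).
  by apply: measurableT_comp => //; exact: measurable_funB.
rewrite (integ_split (c := s))//; last exact: bm_comp.
congr (_ + _).
  transitivity (integ 0 s (fun t => F (s - t))).
    by apply: eq_integ => t t0 ts; rewrite distrC ger0_norm// subr_ge0.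
  by rewrite integ_reflect// subrr subr0.
transitivity (integ s T (fun t => F (t + - s))).
  by apply: eq_integ => t st tT; rewrite ger0_norm// subr_ge0.
by rewrite integ_shift// subrr.
Qed.

(** The double integral of [F `|t - s|] over the square of side [T], after
    [integ_dist]; clamping makes the integrand bounded on the whole line. *)
Definition double_integ : R :=
  integ 0 T (fun s => integ 0 (clamp T s) F + integ 0 (clamp T (T - s)) F).

Let bm_h : bounded_measurable
  (fun s => integ 0 (clamp T s) F + integ 0 (clamp T (T - s)) F).
Proof.
have T0 := ltW T_gt0.
apply: bmD; first exact: bm_primitive.
apply: (bm_comp (f := fun s => integ 0 (clamp T s) F) (h := fun s => T - s)).
  exact: bm_primitive.
exact: measurable_funB.
Qed.

Lemma EFin_double_integ :
  (\int[lebesgue_measure]_(s in `[0%R, T]) \int[lebesgue_measure]_(t in `[0%R, T])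
    (F `|t - s|)%:E = double_integ%:E)%E.
Proof.
rewrite /double_integ EFin_integ//.
apply: eq_integral => s; rewrite inE/= in_itv/= => /andP[s0 sT].
have mabs : measurable_fun [set: R] (fun t : R => `|t - s|).
  by apply: measurableT_comp => //; exact: measurable_funB.
rewrite -EFin_integ; last exact: bm_comp.
by rewrite integ_dist// !clamp_id//; lra.
Qed.

Lemma double_integ_le c : (forall v, 0 <= v -> v <= T -> `|integ 0 v F| <= c) ->
  double_integ <= 2 * T * c.
Proof.
move=> hc; have T0 := ltW T_gt0.
have -> : 2 * T * c = integ 0 T (fun=> 2 * c) by rewrite integ_cst//; ring.
apply: integ_le => //; first exact: bm_cst.
have hcl x : integ 0 (clamp T x) F <= c.
  by apply: le_trans (ler_norm _) (hc _ _ _); [exact: clamp_ge0|exact: clamp_le].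
by move=> s _ _; have := hcl s; have := hcl (T - s); lra.
Qed.

Lemma double_integ_ge e c : 0 <= e -> e <= T / 2 -> 0 <= c ->
  (forall v, 0 <= v -> v <= T -> 0 <= integ 0 v F) ->
  (forall v, e <= v -> v <= T -> c <= integ 0 v F) ->
  T / 2 * c <= double_integ.
Proof.
move=> e0 eT c0 h0 hc; have T0 := ltW T_gt0.
have hcl x : 0 <= integ 0 (clamp T x) F.
  by apply: h0; [exact: clamp_ge0|exact: clamp_le].
rewrite /double_integ (integ_split (c := T / 2))//; try lra.
have -> : T / 2 * c = 0 + integ (T / 2) T (fun=> c) by rewrite integ_cst; lra.
apply: lerD; first by apply: integ_ge0 => x _ _; exact: addr_ge0.
apply: integ_le => //; first exact: bm_cst.
move=> s s0 sT; have := hcl (T - s).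
rewrite (clamp_id (x := s)); [|lra|lra].
have := hc s ltac:(lra) sT; lra.
Qed.

End DoubleIntegral.

(** * The variation of a process with homogeneous increments *)

Section VariationBounds.
Context {R : realType} {d : measure_display} {Omega : measurableType d}.
Variable P : probability Omega R.
Variables (T eps0 : R) (T_gt0 : 0 < T) (eps0_gt0 : 0 < eps0).
Variables (m : nat) (m_gt1 : (1 < m)%N) (m_odd : odd m).
Variables (X : R -> {RV P >-> R}) (delta : R -> R).
Local Notation S := (T + eps0).
Hypothesis X_gaussian : centered_gaussian_process S X.
Hypothesis X_measurable : measurable_process S X.
Hypothesis X_metric : forall s t, s \in `[0, S] -> t \in `[0, S] ->
  'E_P[(fun w => (X t w - X s w) ^+ 2)%R]%E = ((delta `|t - s|) ^+ 2)%:E.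
Hypothesis delta2_increasing :
  {in `[0, S] &, {homo (fun r => delta r ^+ 2) : x y / x <= y}}.
Hypothesis delta2_concave : concave_on `[0, S] (fun r => delta r ^+ 2).
Local Notation mu := (@lebesgue_measure R).
Local Notation Ex f := (\int[P]_w (f w)).

(** The squared metric, made constant outside of [0, S] so that it is monotone
    on the whole line. *)
Definition sq_metric : R -> R := fun r => delta (clamp S r) ^+ 2.
Local Notation g := sq_metric.

Let S_gt0 : 0 < S. Proof. exact: addr_gt0. Qed.

Lemma sq_metricE r : 0 <= r -> r <= S -> g r = delta r ^+ 2.
Proof. by move=> r0 rS; rewrite /sq_metric clamp_id. Qed.

Let g_homo_bm : {homo g : x y / x <= y} /\ bounded_measurable g.
Proof.
apply: (@homo_clamp_bm R S (fun r => delta r ^+ 2)); first exact: ltW.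
move=> x y x0 xy yS; apply: delta2_increasing => //; rewrite in_itv/= ?x0/=.
- exact: le_trans yS.
- by rewrite yS andbT (le_trans x0).
Qed.

Lemma sq_metric_homo : {homo g : x y / x <= y}.
Proof. by case: g_homo_bm. Qed.

Let g_bm : bounded_measurable g.
Proof. by case: g_homo_bm. Qed.

Lemma sq_metric0 : g 0 = 0.
Proof.
have S0 : (0 : R) \in `[0, S] by rewrite in_itv/= lexx ltW.
rewrite sq_metricE ?lexx// ?(ltW S_gt0)//.
have := X_metric S0 S0; rewrite subrr normr0 unlock => h.
have : (0 = (delta 0 ^+ 2)%:E :> \bar R)%E.
  by rewrite -h integral0_eq// => w _; rewrite subrr expr0n.
by case.
Qed.

Lemma sq_metric_ge0 x : 0 <= g x.
Proof. exact: sqr_ge0. Qed.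

Let g_concave x y h : 0 <= x -> x <= y -> 0 <= h -> y + h <= S ->
  g (y + h) - g y <= g (x + h) - g x.
Proof.
move=> x0 xy h0 yS; rewrite !sq_metricE; try lra.
exact: (concave_on_increments delta2_concave).
Qed.

Let diff2 s t : 0 <= s -> s <= S -> 0 <= t -> t <= S ->
  P.-integrable setT (fun w => ((X t w - X s w) ^+ 2)%:E) /\
  Ex (fun w => (X t w - X s w) ^+ 2) = g `|t - s|.
Proof.
move=> s0 sS t0 tS.
have hE : (\int[P]_w ((X t w - X s w) ^+ 2)%:E = (g `|t - s|)%:E)%E.
  have hs : s \in `[0, S] by rewrite in_itv/= s0.
  have ht : t \in `[0, S] by rewrite in_itv/= t0.
  have := X_metric hs ht; rewrite unlock => ->.
  by rewrite sq_metricE// ler_norml; lra.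
split; last by rewrite /Rintegral hE.
apply/integrableP; split.
  by apply/measurable_EFinP; apply: measurable_funX; exact: measurable_funB.
under eq_integral do rewrite gee0_abs ?lee_fin ?sqr_ge0//.
by rewrite hE ltry.
Qed.

Section FixedStep.
Variable e : R.
Hypotheses (e_gt0 : 0 < e) (e_le : e <= eps0).
Local Notation Y s := (fun w => X (s + e) w - X s w).

Let mY s : measurable_fun setT (Y s).
Proof. exact: measurable_funB. Qed.

Let Y_normal s t : 0 <= s -> s <= T -> 0 <= t -> t <= T -> forall a b : R,
  exists v, centered_normal P (fun w => a * Y s w + b * Y t w) v.
Proof.
move=> s0 sT t0 tT a b; have [e0 ee] := (e_gt0, e_le).
have tin (i : 'I_4) : nth 0 [:: s + e; s; t + e; t] i \in `[0, S].
  by case: i => -[|[|[|[|//]]]] ? /=; rewrite in_itv/=; apply/andP; split; lra.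
have [v hv] := X_gaussian (fun i : 'I_4 => nth 0 [:: a; - a; b; - b] i) tin.
exists v; congr centered_normal: hv; apply/funext => w.
by rewrite !big_ord_recr big_ord0/=; ring.
Qed.

Let var_Y s : 0 <= s -> s <= T -> Ex (fun w => Y s w ^+ 2) = g e.
Proof.
move=> s0 sT; have [e0 ee] := (e_gt0, e_le).
have [_ ->] := @diff2 s (s + e) s0 ltac:(lra) ltac:(lra) ltac:(lra).
by congr g; rewrite addrAC subrr add0r ger0_norm// ltW.
Qed.

(* polarization *)
Let cov_Y s t : 0 <= s -> s <= T -> 0 <= t -> t <= T ->
  Ex (fun w => Y s w * Y t w) = incr_cov g e `|t - s|.
Proof.
move=> s0 sT t0 tT; have [e0 ee] := (e_gt0, e_le).
have [i1 h1] := @diff2 t (s + e) t0 ltac:(lra) ltac:(lra) ltac:(lra).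
have [i2 h2] := @diff2 s (t + e) s0 ltac:(lra) ltac:(lra) ltac:(lra).
have [i3 h3] := @diff2 (t + e) (s + e) ltac:(lra) ltac:(lra) ltac:(lra) ltac:(lra).
have [i4 h4] := @diff2 s t s0 ltac:(lra) t0 ltac:(lra).
have i34 := integrableD measurableT i3 i4.
have i12 := integrableD measurableT i1 i2.
have iB := integrableB measurableT i12 i34.
transitivity (Ex (fun w => 2^-1 * (((X (s + e) w - X t w) ^+ 2 + (X (t + e) w - X s w) ^+ 2)
    - ((X (s + e) w - X (t + e) w) ^+ 2 + (X t w - X s w) ^+ 2)))).
  by apply: eq_Rintegral => w _; field.
rewrite RintegralZl// RintegralB// RintegralD// RintegralD// h1 h2 h3 h4.
rewrite /incr_cov mulrC; congr (_ * _).
have -> : s + e - (t + e) = - (t - s) by ring.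
rewrite normrN.
have [st|ts] := leP s t.
  rewrite (ger0_norm (x := t - s)) ?subr_ge0//.
  rewrite (ger0_norm (x := t + e - s)); last lra.
  have -> : s + e - t = - (t - s - e) by ring.
  rewrite normrN; have -> : t + e - s = t - s + e by ring.
  by ring.
rewrite (ltr0_norm (x := t - s)) ?subr_lt0//.
rewrite (ger0_norm (x := s + e - t)); last lra.
have -> : t + e - s = - (- (t - s) - e) by ring.
rewrite normrN; have -> : s + e - t = - (t - s) + e by ring.
by ring.
Qed.

(** The covariance of the [m]-th powers of two increments, as a function of the
    distance of their starting times. *)
Definition power_cov u : R :=
  \sum_(i < m.+1) mixed_coef m i * g e ^+ (m - i) * incr_cov g e u ^+ i.

Let bm_cov : bounded_measurable (incr_cov g e).
Proof. exact: bm_incr_cov. Qed.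

Let bm_power_cov : bounded_measurable power_cov.
Proof.
apply: bm_sum => i; apply: bmM; last exact: bmX.
exact: bm_cst.
Qed.

Let m_gt0 : (0 < m)%N. Proof. exact: ltnW. Qed.

Let YmYm s t : 0 <= s -> s <= T -> 0 <= t -> t <= T ->
  (\int[P]_w (Y s w ^+ m * Y t w ^+ m)%:E = (power_cov `|t - s|)%:E)%E.
Proof.
move=> s0 sT t0 tT.
have iY : P.-integrable setT (fun w => (Y s w ^+ m * Y t w ^+ m)%:E).
  apply: (mixed_integrable (mY s) (mY t) (Y_normal s0 sT t0 tT) (n := m)).
  by rewrite addnn.
rewrite -(fineK (integrable_fin_num measurableT iY)) -/(Rintegral _ _ _); congr EFin.
apply: (mixed_moment (mY s) (mY t)) => //.
- exact: Y_normal.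
- exact: var_Y.
- exact: var_Y.
- exact: cov_Y.
Qed.

(* The process is only known to be measurable at times in [0, S], so the path
   is extended by zero. *)
Let path (p : R * Omega) : R := (X (p.1 + e) p.2 - X p.1 p.2) ^+ m.
Let D : set R := `[0, T]%classic.
Let k := path \_ (D `*` setT).

Let mD : measurable D.
Proof. exact: measurable_itv. Qed.

Let mk : measurable_fun [set: R * Omega] k.
Proof.
have [e0 ee] := (e_gt0, e_le).
have XS : measurable_fun (`[0, S] `*` [set: Omega]) (fun p : R * Omega => X p.1 p.2).
  exact: X_measurable.
have mDT : measurable (D `*` [set: Omega]) by exact: measurableX.
apply/(measurable_restrictT _ mDT).
apply: measurable_funX; apply: measurable_funB; last first.
  apply: measurable_funS XS.
  - exact: measurableX.
  - by move=> -[s w] /= []; rewrite /D /= !in_itv/= => /andP[? ?] _; split => //;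
      apply/andP; split; lra.
pose sh (p : R * Omega) : R * Omega := (p.1 + e, p.2).
have msh : measurable_fun setT sh.
  apply: measurable_fun_pair; last exact: measurable_snd.
  by apply: measurable_funD => //; exact: measurable_fst.
apply: (measurable_comp (F := `[0, S] `*` setT) (f := fun p : R * Omega => X p.1 p.2) (g := sh)).
- exact: measurableX.
- move=> _ [[s w] [/= + _] <-]; rewrite /D /= !in_itv/= => /andP[? ?]; split => //=.
  by apply/andP; split; lra.
- exact: XS.
- exact: measurable_funTS.
Qed.

Let kE s w : 0 <= s -> s <= T -> k (s, w) = Y s w ^+ m.
Proof.
move=> s0 sT; rewrite /k patchE mem_set//; split => //=.
by rewrite /D /= in_itv/= s0.
Qed.

Let k_out s w : ~ D s -> k (s, w) = 0.
Proof.
move=> Ds; rewrite /k patchE; case: ifP => // /set_mem [/= ? _].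
by [].
Qed.

Lemma variation_second_moment :
  'E_P[(fun w => (odd_variation X m T e w) ^+ 2)%R]%E
  = (e^-1 ^+ 2 * double_integ T power_cov)%:E.
Proof.
have muD : (mu D < +oo)%E.
  have := lebesgue_measure_itv `[0, T]; rewrite /= /D => ->.
  by case: ifP => _ //; rewrite -EFinD ltry.
have DT s : D s -> 0 <= s /\ s <= T by rewrite /D /= in_itv/= => /andP.
have k_sqr s : (\int[P]_w (k (s, w) ^+ 2)%:E <= (power_cov 0)%:E)%E.
  have p0 : 0 <= power_cov 0.
    have T0 := ltW T_gt0; have := YmYm (lexx 0) T0 (lexx 0) T0.
    rewrite subrr normr0 -lee_fin => <-.
    by apply: integral_ge0 => w _; rewrite lee_fin -expr2 sqr_ge0.
  have [/DT[s0 sT]|Ds] := pselect (D s); last first.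
    by rewrite integral0_eq// => w _; rewrite k_out// expr0n.
  have := YmYm s0 sT s0 sT; rewrite subrr normr0 => <-.
  rewrite le_eqVlt; apply/orP; left; apply/eqP; apply: eq_integral => w _.
  by rewrite kE// expr2.
have mk' : measurable_fun [set: measurableTypeR R * Omega] k by exact: mk.
have mD' : measurable (D : set (measurableTypeR R)) by exact: mD.
have main := second_moment_integral mD' muD mk' k_out k_sqr.
have HV w : odd_variation X m T e w = e^-1 * fine (\int[mu]_s (k (s, w))%:E).
  rewrite /odd_variation /Rintegral; congr (_ * fine _).
  rewrite integral_mkcond; apply: eq_integral => s _.
  rewrite patchE; case: ifPn => [/set_mem/DT[s0 sT]|/negP sD].
    by rewrite kE.
  by rewrite k_out// => /mem_set.
rewrite unlock.
under eq_integral do rewrite HV exprMn EFinM.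
rewrite ge0_integralZl ?lee_fin ?sqr_ge0//; last 2 first.
- apply/measurable_EFinP; apply: measurable_funX.
  exact: (measurable_path_integral mD' muD mk' k_out k_sqr).
- by move=> w _; rewrite lee_fin sqr_ge0.
rewrite main [in RHS]EFinM; congr (_ * _)%E.
rewrite -EFin_double_integ// [RHS]integral_mkcond; apply: eq_integral => s _.
rewrite patchE; case: ifPn => [/set_mem/DT[s0 sT]|/negP sD]; last first.
  rewrite integral0_eq// => t _; rewrite integral0_eq// => w _.
  by rewrite k_out ?mul0r// => /mem_set.
rewrite [RHS]integral_mkcond; apply: eq_integral => t _.
rewrite patchE; case: ifPn => [/set_mem/DT[t0 tT]|/negP tD]; last first.
  rewrite integral0_eq// => w _.
  by rewrite (@k_out t) ?mulr0// => /mem_set.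
rewrite -YmYm//; apply: eq_integral => w _.
by rewrite !kE.
Qed.
Hypothesis e_leT : e <= T / 2.

Let e2S : e + e <= S.
Proof. by have [[e0 ee] [eT T0]] := ((e_gt0, e_le), (e_leT, T_gt0)); lra. Qed.

Let integ_power_cov v : integ 0 v power_cov
  = \sum_(i < m.+1) mixed_coef m i * g e ^+ (m - i)
      * integ 0 v (fun u => incr_cov g e u ^+ i).
Proof.
rewrite /power_cov integ_sum; last first.
  by move=> i; apply: bmM; [exact: bm_cst|exact: bmX].
by apply: eq_bigr => i _; rewrite integZ//; exact: bmX.
Qed.

Let coef_term_ge0 (i : 'I_m.+1) : 0 <= mixed_coef m i * g e ^+ (m - i).
Proof. by apply: mulr_ge0; [exact: mixed_coef_ge0|apply: exprn_ge0; exact: sq_metric_ge0]. Qed.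

Let term_even (i : 'I_m.+1) : ~~ odd i -> mixed_coef m i = 0 :> R.
Proof. by move=> oi; apply: mixed_coef_even => //; rewrite -ltnS. Qed.

Let term_ge0 v (i : 'I_m.+1) : 0 <= v -> v <= T ->
  0 <= mixed_coef m i * g e ^+ (m - i) * integ 0 v (fun u => incr_cov g e u ^+ i).
Proof.
move=> v0 vT; have [oi|oi] := boolP (odd i); last by rewrite term_even// !mul0r.
apply: mulr_ge0 => //; apply: (integ_incr_cov_ge0 sq_metric_homo g_bm g_concave) => //.
by have [[e0 ee] [eT T0]] := ((e_gt0, e_le), (e_leT, T_gt0)); lra.
Qed.

(** All odd powers of the covariance have nonnegative integrals, so the highest
    one gives a lower bound. *)
Lemma variation_lower :
  T / 2 * (mixed_coef m m * (2^-1 ^+ m * (e / 4 * (g (3 * e / 4) - g (e / 4)) ^+ m)))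
  <= double_integ T power_cov.
Proof.
have [[e0 ee] [eT T0]] := ((e_gt0, e_le), (e_leT, T_gt0)).
have D0 : 0 <= g (3 * e / 4) - g (e / 4).
  by rewrite subr_ge0; apply: sq_metric_homo; lra.
apply: (double_integ_ge T_gt0 bm_power_cov (e := e)) => //.
- exact: ltW.
- apply: mulr_ge0; first exact/ltW/mixed_coef_gt0.
  apply: mulr_ge0; first by rewrite exprn_ge0.
  by apply: mulr_ge0; [rewrite divr_ge0// ltW|exact: exprn_ge0].
- by move=> v v0 vT; rewrite integ_power_cov sumr_ge0// => i _; exact: term_ge0.
move=> v ev vT; have v0 : 0 <= v by lra.
rewrite integ_power_cov (bigD1 ord_max)//= subnn expr0 mulr1.
rewrite -[leLHS]addr0; apply: lerD; last first.
  by apply: sumr_ge0 => i _; exact: term_ge0.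
apply: ler_wpM2l; first exact/ltW/mixed_coef_gt0.
apply: (integ_incr_cov_lower sq_metric_homo g_bm g_concave) => //.
lra.
Qed.

(** Even powers have zero coefficient; in an odd power all factors but one are
    bounded by [g e]. *)
Lemma variation_upper :
  double_integ T power_cov
  <= 2 * T * ((\sum_(i < m.+1) mixed_coef m i) * (2 * e * g e ^+ m)).
Proof.
have [[e0 ee] [eT T0]] := ((e_gt0, e_le), (e_leT, T_gt0)).
apply: double_integ_le => // v v0 vT.
have vS : v + e <= S by lra.
rewrite integ_power_cov mulr_suml.
apply: le_trans (ler_norm_sum _ _ _) _; apply: ler_sum => i _.
have [oi|oi] := boolP (odd i); last by rewrite term_even// !mul0r normr0.
rewrite normrM (ger0_norm (coef_term_ge0 i)) -[leLHS]mulrA.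
apply: ler_wpM2l; first exact: mixed_coef_ge0.
have i0 : (0 < i)%N by case: (nat_of_ord i) oi.
have im : (i <= m)%N by rewrite -ltnS.
have gE : g e ^+ m = g e ^+ (m - i) * (g e ^+ i.-1 * g e).
  by rewrite -exprSr prednK// -exprD subnK.
rewrite gE mulrCA; apply: ler_wpM2l; first by rewrite exprn_ge0 ?sq_metric_ge0.
apply: le_trans (integ_norm _ _ (bmX i bm_cov)) _.
apply: (@le_trans _ _ (integ 0 v (fun u => g e ^+ i.-1 * `|incr_cov g e u|))).
  apply: integ_le => //.
  - by apply: bm_norm; exact: bmX.
  - by apply: bmM; [exact: bm_cst|exact: bm_norm].
  - move=> x x0 xv; rewrite normrX -[in leLHS](prednK i0) exprSr.
    apply: ler_wpM2r => //; apply: lerXn2r; rewrite ?nnegrE ?sq_metric_ge0//.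
    apply: (incr_cov_le sq_metric_homo sq_metric0 g_concave) => //; lra.
rewrite integZ; last exact: bm_norm.
rewrite mulrCA; apply: ler_wpM2l; first by rewrite exprn_ge0 ?sq_metric_ge0.
exact: (integ_norm_incr_cov sq_metric_homo g_bm sq_metric0 g_concave).
Qed.

End FixedStep.
End VariationBounds.

(** * Continuity of the metric at the origin *)

Section MeanSquareSeparability.
Context {R : realType} {d : measure_display} {Omega : measurableType d}.
Variable P : probability Omega R.
Variables (S : R) (W : R -> {RV P >-> R}).
Hypothesis S_gt0 : 0 < S.
Hypothesis W_brownian : brownian_motion S W.

Let norm2 (Y : Omega -> R) : \bar R := (\int[P]_w (Y w ^+ 2)%:E)%E.

Let norm2_ge0 Y : (0 <= norm2 Y)%E.
Proof. by apply: integral_ge0 => w _; rewrite lee_fin sqr_ge0. Qed.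

Let norm2D (Y Z V : Omega -> R) : measurable_fun setT Y -> measurable_fun setT Z ->
  (forall w, V w = Y w + Z w) ->
  (norm2 V <= 2%:E * norm2 Y + 2%:E * norm2 Z)%E.
Proof.
move=> mY mZ hV.
have mY2 : measurable_fun setT (fun w => (Y w ^+ 2)%:E).
  by apply/measurable_EFinP; exact: measurable_funX.
have mZ2 : measurable_fun setT (fun w => (Z w ^+ 2)%:E).
  by apply/measurable_EFinP; exact: measurable_funX.
rewrite /norm2 -!ge0_integralZl//; try by move=> w _; rewrite lee_fin sqr_ge0.
rewrite -ge0_integralD//; last 4 first.
- by move=> w _; rewrite -EFinM lee_fin mulr_ge0// sqr_ge0.
- exact: measurable_funeM.
- by move=> w _; rewrite -EFinM lee_fin mulr_ge0// sqr_ge0.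
- exact: measurable_funeM.
apply: ge0_le_integral => //.
- by move=> w _; rewrite lee_fin sqr_ge0.
- apply/measurable_EFinP; apply: measurable_funX.
  by rewrite (_ : V = Y \+ Z); [exact: measurable_funD|exact/funext].
- by apply: emeasurable_funD; exact: measurable_funeM.
- move=> w _; rewrite -!EFinM -EFinD lee_fin hV.
  by have := sqr_ge0 (Y w - Z w); nra.
Qed.

Let norm2Z (c : R) Y : measurable_fun setT Y ->
  norm2 (fun w => c * Y w) = ((c ^+ 2)%:E * norm2 Y)%E.
Proof.
move=> mY; rewrite /norm2; under eq_integral do rewrite exprMn EFinM.
rewrite ge0_integralZl//.
- by apply/measurable_EFinP; exact: measurable_funX.
- by move=> w _; rewrite lee_fin sqr_ge0.
- by rewrite lee_fin sqr_ge0.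
Qed.

(* Increments from time 0 at clamped times have variance at most [M * S],
   whatever the value of [W 0] on its exceptional null set. *)
Let V (a : R) (w : Omega) : R := W (clamp S a) w - W 0 w.

Let mV a : measurable_fun setT (V a).
Proof. exact: measurable_funB. Qed.

Let M := gauss_moment 1 : R.

Let norm2W a b : 0 <= a -> a <= b -> b <= S ->
  norm2 (fun w => W b w - W a w) = (M * (b - a))%:E.
Proof.
move=> a0 ab bS; have [_ hW _ _] := W_brownian.
have mWW : measurable_fun setT (fun w => W b w - W a w) by exact: measurable_funB.
have := centered_normal_moment (n := 1) isT mWW (hW a b a0 ab bS).
by rewrite unlock sqr_sqrtr ?subr_ge0// mulrC.
Qed.

Let norm2VB a b : (norm2 (fun w => (V a w - V b w)%R) <= (M * `|a - b|)%:E)%E.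
Proof.
have M0 : 0 <= M := ltW (gauss_moment_gt0 1).
wlog ab : a b / b <= a.
  move=> h; have [/h//|/ltW/h] := leP b a.
  rewrite distrC; congr (_ <= _)%E.
  by apply: eq_integral => w _; rewrite -sqrrN opprB.
have -> : norm2 (fun w => V a w - V b w)
    = norm2 (fun w => W (clamp S a) w - W (clamp S b) w).
  by apply: eq_integral => w _; congr (_ ^+ _)%:E; rewrite /V; ring.
rewrite norm2W ?clamp_ge0 ?clamp_le ?(ltW S_gt0) ?clamp_homo// lee_fin.
rewrite ler_wpM2l// ger0_norm ?subr_ge0//.
have : clamp S a - a <= clamp S b - b.
  have S0 := S_gt0; rewrite /clamp; case: (leP a S) => h1; case: (leP b S) => h2;
    case: (leP 0 a) => h3; case: (leP 0 b) => h4; rewrite ?(max_r (ltW S0)); lra.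
lra.
Qed.

Let norm2V_le a : (norm2 (V a) <= (M * S)%:E)%E.
Proof.
have M0 : 0 <= M := ltW (gauss_moment_gt0 1).
rewrite [norm2 _](norm2W (lexx 0) (clamp_ge0 S a) _) ?clamp_le ?(ltW S_gt0)//.
by rewrite lee_fin subr0 ler_wpM2l// clamp_le// ltW.
Qed.

(* The index set is countable, and the combinations are dense in the closed
   span of the increments of [W]. *)
Let combination (q : seq (rat * rat)) (w : Omega) : R :=
  \sum_(x <- q) ratr x.2 * V (ratr x.1) w.

Let m_combination q : measurable_fun setT (combination q).
Proof.
apply: measurable_sum => x; apply: measurable_funM => //.
Qed.

Let approximable (Y : Omega -> R) := forall eta : R, 0 < eta ->
  exists q, (norm2 (fun w => (Y w - combination q w)%R) <= eta%:E)%E.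

Let approximableD (Y Z U : Omega -> R) : measurable_fun setT Y -> measurable_fun setT Z ->
  approximable Y -> approximable Z -> (forall w, U w = Y w + Z w) -> approximable U.
Proof.
move=> mY mZ aY aZ hU eta eta0.
have [q hq] := aY (eta / 4) ltac:(lra).
have [r hr] := aZ (eta / 4) ltac:(lra).
exists (q ++ r); apply: (le_trans (norm2D (Y := fun w => Y w - combination q w)
  (Z := fun w => Z w - combination r w) _ _ _)).
- exact: measurable_funB.
- exact: measurable_funB.
- by move=> w; rewrite hU /combination big_cat/=; ring.
apply: (@le_trans _ _ (2%:E * (eta / 4)%:E + 2%:E * (eta / 4)%:E)%E).
  by apply: leeD; apply: lee_wpmul2l.
by rewrite -EFinM -EFinD lee_fin; lra.
Qed.

Let rat_near (x eta : R) : 0 < eta -> exists q : rat, `|x - ratr q| <= eta.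
Proof.
move=> eta0; have [q] := @rat_in_itvoo R (x - eta) (x + eta) ltac:(lra).
rewrite in_itv/= => /andP[h1 h2]; exists q.
by rewrite ler_norml; apply/andP; split; lra.
Qed.

Let approximable_V (c a : R) : approximable (fun w => c * V a w).
Proof.
move=> eta eta0; have M0 : 0 <= M := ltW (gauss_moment_gt0 1).
have K0 : 0 < 4 * (c ^+ 2 * M + 1).
  by rewrite mulr_gt0// ltr_wpDl// mulr_ge0// sqr_ge0.
have L0 : 0 < 4 * (M * S + 1).
  by rewrite mulr_gt0// ltr_wpDl// mulr_ge0// ltW.
have [p hp] := @rat_near a (eta / (4 * (c ^+ 2 * M + 1))) ltac:(exact: divr_gt0).
have min0 : 0 < Num.min 1 (eta / (4 * (M * S + 1))).
  by rewrite lt_min ltr01 divr_gt0.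
have [r] := rat_near c min0.
rewrite le_min => /andP[r1 r2].
exists [:: (p, r)].
apply: (le_trans (norm2D (Y := fun w => c * (V a w - V (ratr p) w))
  (Z := fun w => (c - ratr r) * V (ratr p) w) _ _ _)).
- by apply: measurable_funM => //; exact: measurable_funB.
- exact: measurable_funM.
- by move=> w; rewrite /combination big_seq1/=; ring.
rewrite norm2Z; last exact: measurable_funB.
rewrite norm2Z//.
apply: (@le_trans _ _ (2%:E * ((c ^+ 2)%:E * (M * `|a - ratr p|)%:E)
   + 2%:E * (((c - ratr r) ^+ 2)%:E * (M * S)%:E))%E).
  by apply: leeD; apply: lee_wpmul2l => //; apply: lee_wpmul2l => //;
    rewrite lee_fin sqr_ge0.
rewrite -!EFinM -EFinD lee_fin.
have h1 : c ^+ 2 * (M * `|a - ratr p|) <= eta / 4.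
  rewrite mulrA; apply: (@le_trans _ _ ((c ^+ 2 * M + 1) * `|a - ratr p|)).
    by rewrite ler_wpM2r// lerDl.
  rewrite -ler_pdivlMl; last lra.
  by apply: le_trans hp _; rewrite invfM mulrA mulrC mulrA.
have h2 : (c - ratr r) ^+ 2 * (M * S) <= eta / 4.
  apply: (@le_trans _ _ (`|c - ratr r| * (M * S + 1))).
    apply: ler_pM; rewrite ?sqr_ge0 ?mulr_ge0 ?(ltW S_gt0)// ?lerDl//.
    by rewrite -real_normK ?num_real// expr2 ler_piMl.
  rewrite -ler_pdivlMr; last lra.
  by apply: le_trans r2 _; rewrite invfM mulrA.
lra.
Qed.

Let approximable_step phi : step_code_in S phi -> approximable (step_integral W phi).
Proof.
elim: phi => [_|x phi IH hphi].
  move=> eta eta0; exists [::]; rewrite /norm2 integral0_eq ?lee_fin ?(ltW eta0)// => w _.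
  by rewrite /step_integral /combination !big_nil subrr expr0n.
have m_step psi : measurable_fun setT (step_integral W psi).
  apply: measurable_sum => y; apply: measurable_funM => //.
  exact: measurable_funB.
have [x0 [x1 x2]] := hphi x (mem_head _ _).
apply: (approximableD (Y := fun w => x.2 * V x.1.2 w + - x.2 * V x.1.1 w)
  (Z := step_integral W phi)) => //.
- by apply: measurable_funD; exact: measurable_funM.
- apply: (approximableD (Y := fun w => x.2 * V x.1.2 w)
    (Z := fun w => - x.2 * V x.1.1 w)) => //; try exact: measurable_funM.
- by apply: IH => y yphi; apply: hphi; rewrite inE yphi orbT.
- move=> w; rewrite /step_integral big_cons; congr (_ + _).
  by rewrite /V !clamp_id; [ring|lra..].
Qed.

Let approximable_wiener f (Y : Omega -> R) : measurable_fun setT Y ->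
  is_wiener_integral S W f Y -> approximable Y.
Proof.
move=> mY [phi [phiS _ hY]] eta eta0.
have m_step psi : measurable_fun setT (step_integral W psi).
  apply: measurable_sum => y; apply: measurable_funM => //.
  exact: measurable_funB.
have [n hn] : exists n, (norm2 (fun w => (Y w - step_integral W (phi n) w)%R) <= (eta / 4)%:E)%E.
  have e4 : 0 < eta / 4 by lra.
  have e40 : (0 < (eta / 4)%:E :> \bar R)%E by rewrite lte_fin.
  have [n _ /(_ n (leqnn n))/=] := hY _ (open_ereal_lt' e40).
  by rewrite unlock => /ltW; exists n.
have [q hq] := approximable_step (phiS n) (eta := eta / 4) ltac:(lra).
exists q; apply: (le_trans (norm2D (Y := fun w => Y w - step_integral W (phi n) w)
  (Z := fun w => step_integral W (phi n) w - combination q w) _ _ _)).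
- exact: measurable_funB.
- exact: measurable_funB.
- by move=> w; ring.
apply: (@le_trans _ _ (2%:E * (eta / 4)%:E + 2%:E * (eta / 4)%:E)%E).
  by apply: leeD; apply: lee_wpmul2l.
by rewrite -EFinM -EFinD lee_fin; lra.
Qed.

(** A process of Wiener integrals lives in a separable subspace of [L^2], so
    uncountably many of its values cannot be at mutual distances bounded away
    from zero. *)
Lemma wiener_process_close_times (X : R -> {RV P >-> R}) (G : R -> R -> R) (c : R) :
  (forall t, t \in `[0, S] -> is_wiener_integral S W (G t) (X t)) -> 0 < c ->
  exists s t, [/\ s \in `[0, S], t \in `[0, S], s < t
    & ('E_P[(fun w => (X t w - X s w) ^+ 2)%R] < c%:E)%E].
Proof.
move=> hX c0; apply: contrapT => far.
have far' s t : s \in `[0, S] -> t \in `[0, S] -> s < t ->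
    (c%:E <= norm2 (fun w => (X t w - X s w)%R))%E.
  move=> hs ht st; rewrite leNgt; apply/negP => h; apply: far.
  by exists s, t; split => //; rewrite unlock.
have /choice[q hq] : forall t, exists q, t \in `[0, S] ->
    (norm2 (fun w => (X t w - combination q w)%R) <= (c / 8)%:E)%E.
  move=> t; have [ht|//] := boolP (t \in `[0, S]); last by exists [::].
  have c8 : 0 < c / 8 by lra.
  have mXt : measurable_fun setT (X t) by [].
  by have [q hq] := approximable_wiener mXt (hX t ht) c8; exists q.
have inj s t : s \in `[0, S] -> t \in `[0, S] -> s < t -> q s <> q t.
  move=> hs ht st qq.
  have := far' s t hs ht st; apply/negP; rewrite -ltNge.
  apply: (@le_lt_trans _ _ (2%:E * (c / 8)%:E + 2%:E * (c / 8)%:E)%E).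
    apply: (le_trans (norm2D (Y := fun w => X t w - combination (q t) w)
      (Z := fun w => - 1 * (X s w - combination (q s) w)) _ _ _)).
    - exact: measurable_funB.
    - by apply: measurable_funM => //; exact: measurable_funB.
    - by move=> w; rewrite qq; ring.
    rewrite norm2Z; last exact: measurable_funB.
    rewrite sqrrN expr1n mul1e.
    by apply: leeD; apply: lee_wpmul2l => //; exact: hq.
  by rewrite -EFinM -EFinD lte_fin; lra.
have cS : countable (`[0, S]%classic : set R).
  apply/countable_injP; exists (pickle \o q) => s t; rewrite !inE/= => hs ht.
  move=> /(pcan_inj pickleK) qq; apply: contrapT => /eqP.
  rewrite neq_lt => /orP[st|ts]; first exact: (inj s t).
  by apply: (inj t s).
have := countable_lebesgue_measure0 cS.
have := lebesgue_measure_itv `[0, S]; rewrite /= lte_fin S_gt0 => -> /eqP.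
by rewrite oppr0 adde0 eqe gt_eqF.
Qed.

End MeanSquareSeparability.

(** * Small increments and the equivalence *)

Section SmallIncrements.
Context {R : realType}.

Lemma near_right0 (Q : R -> Prop) :
  (\forall r \near 0^'+, Q r) <->
  exists2 r0, 0 < r0 & forall r, 0 < r -> r < r0 -> Q r.
Proof.
split=> [[/= r0 r00 h]|[r0 r00 h]].
  exists r0 => // r rpos rr0; apply: h => //=.
  by rewrite sub0r normrN gtr0_norm.
exists r0 => //= r; rewrite /= sub0r normrN => rr0 rpos.
by apply: h => //; rewrite gtr0_norm in rr0.
Qed.

(** The increments of [g] are summed along the geometric sequence
    [r / 3 ^ n]. *)
Lemma telescope_small (g a : R -> R) (eta r0 q : R) :
  {homo g : x y / x <= y} ->
  (forall c, 0 < c -> exists2 r, 0 < r & g r < c) ->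
  0 <= q -> q < 1 -> 0 <= eta -> (forall r, 0 <= a r) ->
  (forall r, 0 <= r -> a (r / 3) = q * a r) ->
  (forall r, 0 < r -> r < r0 -> g (3 * r) - g r <= eta * a r) ->
  forall r, 0 < r -> r < r0 -> g r <= q / (1 - q) * (eta * a r).
Proof.
move=> g_homo g_lim q0 q1 eta0 a0 a3 incr r rpos rr0.
have q1' : 0 < 1 - q by rewrite subr_gt0.
apply/ler_addgt0Pr => c c0.
have [r1 r10 hr1] := g_lim c c0.
have rec n : forall s, 0 < s -> s < r0 ->
    g s <= g (s / 3 ^+ n) + q / (1 - q) * (eta * a s).
  elim: n => [|n IH] s spos sr0.
    by rewrite expr0 divr1 lerDl !mulr_ge0// invr_ge0 ltW.
  have s3 : 0 < s / 3 by rewrite divr_gt0.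
  have s3r : s / 3 < r0 by lra.
  have h1 := incr _ s3 s3r; have h2 := IH _ s3 s3r.
  have e3 : 3 * (s / 3) = s by field.
  rewrite e3 in h1.
  rewrite (a3 s (ltW spos)) in h1 h2.
  have -> : s / 3 ^+ n.+1 = s / 3 / 3 ^+ n by rewrite exprS invfM mulrA.
  have e4 : q / (1 - q) * (eta * a s)
      = eta * (q * a s) + q / (1 - q) * (eta * (q * a s)).
    by field; rewrite gt_eqF.
  rewrite e4; lra.
pose n := Num.bound (r / r1).
apply: le_trans (rec n r rpos rr0) _; rewrite addrC lerD2l.
apply: le_trans (ltW hr1); apply: g_homo.
rewrite ler_pdivrMr ?exprn_gt0// mulrC -ler_pdivrMr//.
apply: le_trans (ltW (archi_boundP _)) _; first by rewrite divr_ge0 ?ltW.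
rewrite -/n -natrX ler_nat.
by elim: (n) => // k IH; rewrite expnS; lia.
Qed.

Lemma root_powE (m : nat) (r : R) : (0 < m)%N -> 0 <= r ->
  (r `^ (2 * m%:R)^-1) ^+ 2 ^+ m = r.
Proof.
move=> m0 r0; rewrite -exprM -powR_mulrn ?powR_ge0// -powRrM natrM.
by rewrite mulVf ?powRr1// mulf_neq0// pnatr_eq0 -lt0n.
Qed.

End SmallIncrements.


Theorem theorem6 (R : realType) (d : measure_display)
    (Omega : measurableType d) (P : probability Omega R)
    (T eps0 : R) (T_gt0 : 0 < T) (eps0_gt0 : 0 < eps0)
    (m : nat) (m_gt1 : (1 < m)%N) (m_odd : odd m)
    (X W : R -> {RV P >-> R}) (G : R -> R -> R) (delta : R -> R)
    (X_gaussian : centered_gaussian_process (T + eps0) X)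
    (X_measurable : measurable_process (T + eps0) X)
    (X_repr : is_wiener_representation (T + eps0) W G X)
    (delta_ge0 : forall r, r \in `[0, T + eps0] -> 0 <= delta r)
    (X_metric : forall s t, s \in `[0, T + eps0] -> t \in `[0, T + eps0] ->
       'E_P[(fun w => (X t w - X s w) ^+ 2)%R]%E = ((delta `|t - s|) ^+ 2)%:E)
    (delta2_increasing :
       {in `[0, T + eps0] &, {homo (fun r => delta r ^+ 2) : x y / x <= y}})
    (delta2_concave : concave_on `[0, T + eps0] (fun r => delta r ^+ 2)) :
  has_zero_odd_variation X m T <->
  delta =o_ (0^'+) (fun r : R => r `^ (2 * m%:R)^-1).
Proof.
have m0 : (0 < m)%N by exact: ltnW.
have S_gt0 : 0 < T + eps0 by exact: addr_gt0.
pose g := sq_metric T eps0 delta.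
have g_homo : {homo g : x y / x <= y} by exact: sq_metric_homo.
have g_ge0 x : 0 <= g x by exact: sq_metric_ge0.
have gE r : 0 <= r -> r <= T + eps0 -> g r = delta r ^+ 2 by exact: sq_metricE.
pose b (r : R) := r `^ (2 * m%:R)^-1.
have b_ge0 r : 0 <= b r by exact: powR_ge0.
have bm r : 0 <= r -> (b r ^+ 2) ^+ m = r by exact: root_powE.
pose V e := e^-1 ^+ 2 * double_integ T (power_cov T eps0 m delta e).
have VE e : 0 < e -> e <= eps0 ->
    'E_P[(fun w => (odd_variation X m T e w) ^+ 2)%R]%E = (V e)%:E.
  by move=> e0 ee; apply: variation_second_moment.
pose C : R := 4 * T * \sum_(i < m.+1) mixed_coef m i.
have C_ge0 : 0 <= C.
  rewrite /C mulr_ge0// ?mulr_ge0 ?(ltW T_gt0)//.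
  by apply: sumr_ge0 => i _; exact: mixed_coef_ge0.
have V_upper e : 0 < e -> e <= eps0 -> e <= T / 2 -> V e <= C * (e^-1 * g e ^+ m).
  move=> e0 ee eT.
  have /= h := variation_upper T_gt0 eps0_gt0 m_odd X_metric delta2_increasing
    delta2_concave e0 ee eT.
  apply: le_trans (ler_wpM2l (sqr_ge0 _) h) _.
  by rewrite /C -/g le_eqVlt; apply/orP; left; apply/eqP; field; rewrite gt_eqF.
pose c : R := T / 8 * (mixed_coef m m * 2^-1 ^+ m).
have c_gt0 : 0 < c.
  by rewrite /c mulr_gt0 ?divr_gt0// mulr_gt0 ?mixed_coef_gt0// exprn_gt0.
have V_lower e : 0 < e -> e <= eps0 -> e <= T / 2 ->
    c * (e^-1 * (g (3 * e / 4) - g (e / 4)) ^+ m) <= V e.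
  move=> e0 ee eT.
  have /= h := variation_lower T_gt0 eps0_gt0 m_gt1 m_odd delta2_increasing delta2_concave e0 ee eT.
  apply: le_trans (ler_wpM2l (sqr_ge0 e^-1) h).
  by rewrite /c -/g le_eqVlt; apply/orP; left; apply/eqP; field; rewrite gt_eqF.
have V_ge0 e : 0 < e -> e <= eps0 -> 0 <= V e.
  move=> e0 ee; rewrite -lee_fin -VE// unlock.
  by apply: integral_ge0 => w _; rewrite lee_fin sqr_ge0.
pose e_max := Num.min eps0 (T / 2).
have e_max0 : 0 < e_max by rewrite lt_min eps0_gt0 divr_gt0.
have e_maxP e : e < e_max -> e <= eps0 /\ e <= T / 2.
  by rewrite lt_min => /andP[/ltW ? /ltW ?].
(* Unfolding the two limits leaves inequalities between real functions. *)
have zeroP : has_zero_odd_variation X m T <-> forall tau, 0 < tau ->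
    exists2 r0, 0 < r0 & forall e, 0 < e -> e < r0 -> V e <= tau.
  rewrite /has_zero_odd_variation; split => [hV tau tau0|hV].
    have tau0' : (0 < tau%:E :> \bar R)%E by rewrite lte_fin.
    have /near_right0[r0 r00 h] := hV _ (open_ereal_lt' tau0').
    exists (Num.min r0 e_max); first by rewrite lt_min r00.
    move=> e e0; rewrite lt_min => /andP[er /e_maxP[ee _]].
    by have := h e e0 er; rewrite /= VE// lte_fin => /ltW.
  move=> A /= [tau /= tau0 hA]; apply/near_right0.
  have [r0 r00 h] := hV (tau / 2) ltac:(lra).
  exists (Num.min r0 e_max); first by rewrite lt_min r00.
  move=> e e0; rewrite lt_min => /andP[er /e_maxP[ee _]].
  rewrite /= VE//; apply: hA => /=.
  by rewrite sub0r normrN ger0_norm ?V_ge0//; have := h e e0 er; lra.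
have littleP : delta =o_ (0^'+) b <-> forall eta, 0 < eta ->
    exists2 r0, 0 < r0 & forall r, 0 < r -> r < r0 -> g r <= eta * b r ^+ 2.
  split => [/eqoP h eta eta0|h].
    have /near_right0[r0 r00 h'] := h (Num.sqrt eta) ltac:(rewrite sqrtr_gt0//).
    exists (Num.min r0 e_max); first by rewrite lt_min r00.
    move=> r rpos; rewrite lt_min => /andP[rr /e_maxP[re _]].
    rewrite gE ?(ltW rpos)//; last by rewrite (le_trans re)// lerDr ltW.
    have := h' r rpos rr.
    rewrite (ger0_norm (b_ge0 r)) => h2.
    rewrite -(sqr_sqrtr (ltW eta0)) -exprMn -real_normK ?num_real//.
    by rewrite lerXn2r// nnegrE ?mulr_ge0 ?sqrtr_ge0.
  apply/eqoP => eps eps_gt0; apply/near_right0.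
  have [r0 r00 h'] := h (eps ^+ 2) ltac:(rewrite exprn_gt0//).
  exists (Num.min r0 e_max); first by rewrite lt_min r00.
  move=> r rpos; rewrite lt_min => /andP[rr /e_maxP[re _]].
  have := h' r rpos rr.
  rewrite gE ?(ltW rpos)//; last by rewrite (le_trans re)// lerDr ltW.
  rewrite (ger0_norm (b_ge0 r)) -exprMn -real_normK ?num_real//.
  by rewrite ler_pXn2r// nnegrE mulr_ge0// ltW.
apply: (iff_trans zeroP); apply: (iff_trans _ (iff_sym littleP)).
split => h.
  pose q := b 3^-1 ^+ 2.
  have q_ge0 : 0 <= q by exact: sqr_ge0.
  have q_lt1 : q < 1.
    rewrite ltNge; apply/negP => q1.
    have := exprn_ege1 m q1; rewrite bm// leNgt => /negP; apply.
    by rewrite invf_lt1// ltr1n.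
  have g_lim c' : 0 < c' -> exists2 r, 0 < r & g r < c'.
    move=> c'0; have [BW _ _ XW] := X_repr.
    have [s [t [hs ht st]]] := wiener_process_close_times S_gt0 BW XW c'0.
    rewrite X_metric// lte_fin => hlt; exists `|t - s|.
      by rewrite normr_gt0 subr_eq0 gt_eqF.
    move: hs ht; rewrite !in_itv/= => /andP[s0 sS] /andP[t0 tS].
    by rewrite gE// ger0_norm ?subr_ge0 ?(ltW st)//; lra.
  move=> eta eta0.
  (* The geometric series costs a factor [q / (1 - q)]. *)
  pose eta' := eta * (1 - q).
  have eta'0 : 0 < eta' by rewrite mulr_gt0// subr_gt0.
  have [r0 r00 hr0] := h (c * eta' ^+ m / 4) ltac:(
    rewrite divr_gt0// mulr_gt0// exprn_gt0//).
  (* the lower bound at the step [4 * r] *)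
  have incr r : 0 < r -> r < Num.min r0 e_max / 4 ->
      g (3 * r) - g r <= eta' * b r ^+ 2.
    move=> rpos rr; have [r1 /e_maxP[r2 r3]] : 4 * r < r0 /\ 4 * r < e_max.
      by apply/andP; rewrite -lt_min; lra.
    have r4 : 0 < 4 * r by rewrite mulr_gt0.
    have := le_trans (V_lower _ r4 r2 r3) (hr0 _ r4 r1).
    have -> : 3 * (4 * r) / 4 = 3 * r by field.
    have -> : 4 * r / 4 = r by field.
    have -> : c * ((4 * r)^-1 * (g (3 * r) - g r) ^+ m)
        = c / (4 * r) * (g (3 * r) - g r) ^+ m by ring.
    rewrite -ler_pdivlMl ?divr_gt0//.
    have -> : (c / (4 * r))^-1 * (c * eta' ^+ m / 4) = (eta' * b r ^+ 2) ^+ m.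
      by rewrite [(eta' * _) ^+ m]exprMn bm ?(ltW rpos)//; field; rewrite !gt_eqF.
    rewrite ler_pXn2r// nnegrE.
      by rewrite subr_ge0; apply: g_homo; lra.
    by rewrite mulr_ge0 ?sqr_ge0// ltW.
  exists (Num.min r0 e_max / 4); first by rewrite divr_gt0// lt_min r00.
  move=> r rpos rr.
  have := telescope_small (a := fun r => b r ^+ 2) g_homo g_lim q_ge0 q_lt1
     (ltW eta'0) (fun r => sqr_ge0 _) _ incr rpos rr.
  move=> /(_ _) tel; apply: le_trans (tel _) _.
    by move=> s s0; rewrite /q -exprMn mulrC /b powRM// invr_ge0.
  rewrite /eta' [leLHS](_ : _ = q * (eta * b r ^+ 2)); last first.
    by field; rewrite gt_eqF// subr_gt0.
  by rewrite ler_piMl ?(ltW q_lt1)// mulr_ge0 ?sqr_ge0// ltW.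
move=> tau tau0.
pose eta := Num.min 1 (tau / (C + 1)).
have C1 : 0 < C + 1 by rewrite ltr_wpDl.
have eta0 : 0 < eta by rewrite lt_min ltr01 divr_gt0.
have [r0 r00 hr0] := h eta eta0.
exists (Num.min r0 e_max); first by rewrite lt_min r00.
move=> e e0; rewrite lt_min => /andP[er /e_maxP[ee eT]].
apply: le_trans (V_upper e e0 ee eT) _.
have h1 : g e ^+ m <= eta ^+ m * e.
  rewrite -{2}(bm e (ltW e0)) -exprMn lerXn2r ?nnegrE ?g_ge0//.
    by rewrite mulr_ge0 ?sqr_ge0// ltW.
  exact: hr0.
have h2 : eta ^+ m <= eta.
  rewrite -(prednK m0) exprS ler_piMr ?(ltW eta0)// exprn_ile1 ?(ltW eta0)//.
  by rewrite ge_min lexx.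
have h3 : e^-1 * g e ^+ m <= eta.
  rewrite ler_pdivrMl//; apply: le_trans h1 _.
  by rewrite mulrC ler_wpM2l// ltW.
apply: le_trans (ler_wpM2l C_ge0 h3) _.
apply: (@le_trans _ _ ((C + 1) * eta)).
  by rewrite ler_wpM2r ?(ltW eta0)// lerDl.
by rewrite -ler_pdivlMl// mulrC ge_min lexx orbT.
Qed.
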